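(* Let $k\le d$ be positive integers. Given a $k$-dimensional mass assignment $\mu$ in $\mathbb{R}^d$ and $d-1$ assignments of continuous functions to $k$-dimensional half-spaces $f_1,\ldots,f_{d-1}$ of $\mathbb{R}^d$, there exist a $(k-1)$-vertical $k$-dimensional linear subspace $S_k$ of $\mathbb{R}^d$ and a $(k-1)$-dimensional affine subspace $S_{k-1}\subset S_k$ such that $S_{k-1}$ bisects $\mu^{S_k}$ and bisects all the functions $f_1,\ldots,f_{d-1}$ on $S_k$.
   Context: Let $A_k(\mathbb{R}^d)$ be the space of $k$-dimensional affine subspaces of $\mathbb{R}^d$ (with its usual topology). For $V\in A_k(\mathbb{R}^d)$, let $M_k(V)$ be the space of finite measures on $V$ that are absolutely continuous with respect to the $k$-dimensional Lebesgue measure of $V$, with the weak topology. A $k$-dimensional mass assignment $\mu$ in $\mathbb{R}^d$ is a (continuous) section $V\mapsto(V,\mu^V)$ of the fibre bundle $\{(V,\nu): V\in A_k(\mathbb{R}^d),\ \nu\in M_k(V)\}\to A_k(\mathbb{R}^d)$, $(V,\nu)\mapsto V$; i.e. it assigns continuously a measure $\mu^V\in M_k(V)$ to every $V\in A_k(\mathbb{R}^d)$. Let $HS_k(\mathbb{R}^d)$ be the space of all closed half-spaces of $k$-dimensional affine subspaces of $\mathbb{R}^d$ (with its natural topology). An assignment of continuous functions to $k$-dimensional half-spaces is a continuous function $f:HS_k(\mathbb{R}^d)\to\mathbb{R}$. Let $S_{k-1}\subset S_k$ be affine subspaces of dimensions $k-1$ and $k$, and let $S_{k-1}^+,S_{k-1}^-$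 be the two closed half-spaces of $S_k$ bounded by $S_{k-1}$. We say $S_{k-1}$ bisects $f$ on $S_k$ if $f(S_{k-1}^+)=f(S_{k-1}^-)$, and $S_{k-1}$ bisects $\mu^{S_k}$ if $\mu^{S_k}(S_{k-1}^+)=\mu^{S_k}(S_{k-1}^-)$. With $e_1,\ldots,e_d$ the canonical basis of $\mathbb{R}^d$, an affine subspace $S$ is $j$-vertical if it contains rays in the directions $e_{d-j+1},\ldots,e_{d-1},e_d$ (the last $j$ basis vectors; for $j=0$ this is no condition).
   Formalization: The formal theorem additionally assumes that the measure of the mass assignment is non-zero on every (k-1)-vertical k-dimensional linear subspace; if zero measures are allowed there, the claim fails already for k=1, d=2. *)

(* Defs.v *)
From HB Require Import structures.
From mathcomp Require Import all_boot all_order all_algebra.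
From mathcomp Require Import all_classical all_reals all_analysis.
Import Order.TTheory GRing.Theory Num.Theory.
Import numFieldNormedType.Exports.

Set Implicit Arguments.
Unset Strict Implicit.
Unset Printing Implicit Defensive.

Local Open Scope classical_set_scope.
Local Open Scope ring_scope.

Definition flat_frames (R : realType) (d k : nat) :
    set ('rV[R]_d * 'M[R]_(k, d)) :=
  [set p | p.2 *m p.2^T = 1%:M].

Definition flat_span (R : realType) (d k : nat)
    (p : 'rV[R]_d * 'M[R]_(k, d)) : set 'rV[R]_d :=
  [set p.1 + c *m p.2 | c in [set: 'rV[R]_k]].

(* The space A_k(R^d).  Its topology is the quotient topology under
   (x, B) |-> x + rowspan B, with (x, B) ranging over R^d times the Stiefel
   manifold of orthonormal k-frames. *)
Record flat (R : realType) (d k : nat) := Flat {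
  flat_set :> set 'rV[R]_d;
  flatP : exists2 p, flat_frames p & flat_set = @flat_span R d k p
}.

Section flat_topology.
Context (R : realType) (d k : nat).

Definition flat_frame (V : flat R d k) : set_type (@flat_frames R d k) :=
  SigSub (mem_set (s2valP (cid2 (flatP V)))).

Definition flat_of_frame (p : set_type (@flat_frames R d k)) : flat R d k :=
  Flat (ex_intro2 _ _ (val p) (set_valP p) erefl).

Lemma flat_inj (V W : flat R d k) : flat_set V = flat_set W -> V = W.
Proof.
case: V W => [V pV] [W pW] /= VW; case: _ / VW pW => pW.
by congr Flat; exact: Prop_irrelevance.
Qed.

Lemma flat_frameK : cancel flat_frame flat_of_frame.
Proof.
by move=> V; apply: flat_inj; rewrite [RHS](s2valP' (cid2 (flatP V))).
Qed.

HB.instance Definition _ := isQuotient.Build _ (flat R d k) flat_frameK.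
HB.instance Definition _ :=
  Topological.copy (flat R d k) (quotient_topology (flat R d k)).

End flat_topology.

Definition half_flat_frames (R : realType) (d k : nat) :
    set ('rV[R]_d * ('rV[R]_d * 'M[R]_(k.-1, d))) :=
  [set p | let W := col_mx p.2.1 p.2.2 in W *m W^T = 1%:M].

Definition half_flat_span (R : realType) (d k : nat)
    (p : 'rV[R]_d * ('rV[R]_d * 'M[R]_(k.-1, d))) : set 'rV[R]_d :=
  [set y | exists t (c : 'rV[R]_(k.-1)),
     0 <= t /\ y = p.1 + t *: p.2.1 + c *m p.2.2].

(* The space HS_k(R^d), for 0 < k: the triple (x, v, B) describes the closed
   half-space x + [0, +oo[ v + rowspan B, whose boundary is the (k-1)-flat
   x + rowspan B and whose inward unit normal is v.  The topology is again the
   quotient topology. *)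
Record half_flat (R : realType) (d k : nat) := HalfFlat {
  half_flat_set :> set 'rV[R]_d;
  half_flatP : exists2 p, half_flat_frames p &
                 half_flat_set = @half_flat_span R d k p
}.

Section half_flat_topology.
Context (R : realType) (d k : nat).

Definition half_flat_frame (H : half_flat R d k) :
    set_type (@half_flat_frames R d k) :=
  SigSub (mem_set (s2valP (cid2 (half_flatP H)))).

Definition half_flat_of_frame (p : set_type (@half_flat_frames R d k)) :
    half_flat R d k :=
  HalfFlat (ex_intro2 _ _ (val p) (set_valP p) erefl).

Lemma half_flat_inj (H K : half_flat R d k) :
  half_flat_set H = half_flat_set K -> H = K.
Proof.
case: H K => [H pH] [K pK] /= HK; case: _ / HK pK => pK.
by congr HalfFlat; exact: Prop_irrelevance.
Qed.

Lemma half_flat_frameK : cancel half_flat_frame half_flat_of_frame.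
Proof.
by move=> H; apply: half_flat_inj; rewrite [RHS](s2valP' (cid2 (half_flatP H))).
Qed.

HB.instance Definition _ := isQuotient.Build _ (half_flat R d k) half_flat_frameK.
HB.instance Definition _ :=
  Topological.copy (half_flat R d k) (quotient_topology (half_flat R d k)).

End half_flat_topology.

(* R^d with its Borel sigma-algebra *)
Notation borel_rV R d := (g_sigma_algebraType (@open 'rV[R]_d)).

(* k-dimensional Lebesgue measure, as the k-fold product of lebesgue_measure:
   the successor case is product_measure1, with R^(k+1) seen as R * R^k. *)
Fixpoint lebesgue_rV (R : realType) (k : nat) : set 'rV[R]_k -> \bar R :=
  match k with
  | 0 => fun A => (\1_A (0 : 'rV[R]_0))%:E
  | k'.+1 => fun A => (\int[@lebesgue_measure R]_x
      lebesgue_rV [set y | A (row_mx x%:M y : 'rV[R]_(1 + k'))])%E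
  end.

(* k-dimensional Lebesgue measure of V, seen as a set function on R^d carried
   by V. As frames are orthonormal, c |-> x + c *m B is an isometry from R^k
   onto V, and the values on Borel sets do not depend on the frame. *)
Definition flat_lebesgue (R : realType) (d k : nat) (V : flat R d k)
    (A : set (borel_rV R d)) : \bar R :=
  let p := val (flat_frame V) in
  lebesgue_rV [set c | A (p.1 + c *m p.2)].

(* M_k(V).  A measure on V is identified with its extension by zero to the
   Borel sets of R^d: absolute continuity forces the complement of V, which is
   flat_lebesgue-null, to be null. *)
Record mass (R : realType) (d k : nat) (V : flat R d k) := Mass {
  mass_measure :> {finite_measure set (borel_rV R d) -> \bar R};
  mass_ac : mass_measure `<< flat_lebesgue V
}.

Definition bounded_continuous (R : realType) (d : nat) : set ('rV[R]_d -> R) :=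
  [set h | continuous h /\ exists M, forall x, `|h x| <= M].

(* The total space {(V, nu) : V in A_k(R^d), nu in M_k(V)}. *)
Record mass_bundle (R : realType) (d k : nat) := MassBundle {
  bundle_base : flat R d k;
  bundle_mass : mass bundle_base
}.

Section mass_bundle_topology.
Context (R : realType) (d k : nat).

(* The topology of the total space is the coarsest one for which the projection
   (V, nu) |-> V and the maps (V, nu) |-> \int h dnu, for h bounded and
   continuous on R^d, are continuous; on each fibre it is the weak topology. *)
Definition bundle_coord (p : mass_bundle R d k) :
    flat R d k * {ptws set_type (@bounded_continuous R d) -> R} :=
  (bundle_base p,
   fun h => \int[bundle_mass p]_(x in [set: borel_rV R d]) val h x).

HB.instance Definition _ := gen_eqMixin (mass_bundle R d k).
HB.instance Definition _ := gen_choiceMixin (mass_bundle R d k).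
HB.instance Definition _ :=
  Topological.copy (mass_bundle R d k) (initial_topology bundle_coord).

End mass_bundle_topology.

(* A k-dimensional mass assignment: a continuous section of bundle_base. *)
Record mass_assignment (R : realType) (d k : nat) := MassAssignment {
  mass_at :> forall V : flat R d k, mass V;
  mass_at_continuous : continuous (fun V => MassBundle (mass_at V))
}.

(* Hp and Hm are the two closed half-spaces of S bounded by T. *)
Definition sides (R : realType) (d k : nat) (S : flat R d k)
    (T : flat R d k.-1) (Hp Hm : half_flat R d k) : Prop :=
  exists (n : 'rV[R]_d) (a : R),
    let u (y : 'rV[R]_d) := (y *m n^T) 0 0 in
    [/\ T = S `&` [set y | u y = a] :> set 'rV[R]_d,
        Hp = S `&` [set y | a <= u y] :> set 'rV[R]_d &
        Hm = S `&` [set y | u y <= a] :> set 'rV[R]_d].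

Definition bisects (R : realType) (d k : nat) (X : Type)
    (f : half_flat R d k -> X) (S : flat R d k) (T : flat R d k.-1) : Prop :=
  exists Hp Hm, sides S T Hp Hm /\ f Hp = f Hm.

Definition vertical (R : realType) (d k j : nat) (V : flat R d k) : Prop :=
  forall i : 'I_d, (d - j <= i)%N ->
    exists x : 'rV[R]_d, forall t : R, 0 <= t -> flat_set V (x + t *: delta_mx 0 i).

Definition is_linear (R : realType) (d k : nat) (V : flat R d k) : Prop :=
  flat_set V 0.

(* Main.v *)
(* A (k-1)-vertical linear k-flat is spanned by a unit vector v of R^(d-k+1) and
   by the last k-1 basis vectors, so that its hyperplanes are given by v, a unit
   normal n = (u0 v, w) with u0 >= 0 and an offset a.  Let p = d-k and q = k-1.
   The pairs (v, n), up to the sign of v if u0 = 0, form the blow-up of the sphere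
   S^(p+q) along the subsphere S^(q-1) of all (0, w), and the differences of the
   values on the two sides of the hyperplane are d real functions of (v, n, a) that
   are odd under (n, a) -> (-n, -a).  They have a common zero, by a Borsuk-Ulam theorem for the
   blow-up, whose proof is the following.  Let h(a, b) be the cell
   S^a_+ x S^b_+ x [-1,1] of the blow-up times an interval of offsets, and let s_k
   be the sign of the k-th function on the vertices of a fine grid, a Z/2-valued
   0-cochain.  The value W(a, b) on h(a, b) of the cup product of the cocycles
   delta s_0, ..., delta s_(a+b) satisfies, because the s_k are odd,
   W(a, b) = [a > 0][b = q] W(a-1, q) + [b > 0] W(a, b-1), hence W(p, q) = W(0, 0),
   and W(0, 0) = 1 since the mass difference changes sign along the interval of
   offsets.  Thus some small cell sees a sign change of each of the d functions. *)
Require Import Defs.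
From HB Require Import structures.
From mathcomp Require Import all_boot all_order all_algebra.
From mathcomp Require Import all_classical all_reals all_analysis.
From mathcomp Require Import measurable_realfun.
From mathcomp Require Import zify ring lra.
Import Order.TTheory GRing.Theory Num.Theory.
Import numFieldNormedType.Exports.

Set Implicit Arguments.
Unset Strict Implicit.
Unset Printing Implicit Defensive.

Local Open Scope classical_set_scope.
Local Open Scope ring_scope.

(** * Cup products on the cubical grid *)

Lemma F2_addxx (x : 'F_2) : x + x = 0.
Proof. by apply: addrr_pchar2; exact: pchar_Fp. Qed.

(** The terms at [(i, j)] and [(j, i)] cancel modulo 2. *)
Lemma F2_sum_symmetric n (G : 'I_n -> 'I_n -> 'F_2) :
  (forall i j, G i j = G j i) -> (forall i, G i i = 0) ->
  \sum_i \sum_j G i j = 0.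
Proof.
move=> Gsym G0.
rewrite (eq_bigr (fun i : 'I_n => \sum_(j < n | (j < i)%N) G i j +
                           \sum_(j < n | (i < j)%N) G i j)); last first.
  move=> i _; rewrite (bigID (fun j : 'I_n => (j < i)%N)) /=; congr (_ + _).
  rewrite (bigD1 i) ?ltnn //= G0 add0r; apply: eq_bigl => j.
  by rewrite -leqNgt ltn_neqAle andbC eq_sym.
rewrite big_split /= [X in _ + X](exchange_big_dep predT) //=.
rewrite [X in _ + X](_ : _ = \sum_(i < n) \sum_(j < n | (j < i)%N) G i j) ?F2_addxx //.
by apply: eq_bigr => i _; apply: eq_bigr => j _; exact: Gsym.
Qed.

Lemma F2_natr_addb (b c : bool) : (b (+) c)%:R = b%:R + c%:R :> 'F_2.
Proof. by case: b; case: c => //=; rewrite ?addr0 ?add0r ?F2_addxx. Qed.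

Lemma F2_telescope n (u : nat -> 'F_2) :
  \sum_(i < n) (u i + u i.+1) = u 0%N + u n.
Proof.
elim: n => [|n IHn]; first by rewrite big_ord0 F2_addxx.
by rewrite big_ord_recr IHn /= addrA -(addrA (u 0%N)) F2_addxx addr0.
Qed.

Section GridCochains.

(* A point of [Z^m] stands for the cell of the cubical grid [(2Z)^m] centred at
   it: the cell has one free direction per odd coordinate, and its two facets
   in the direction [j] are centred at the neighbours [step j _ x]. *)
Definition gridpt := nat -> int.

Implicit Types (x y z : gridpt) (B : gridpt -> 'F_2).

Definition upd x j (v : int) : gridpt := fun i => if i == j then v else x i.

Definition oddz (v : int) := odd `|v|%N.

Definition step j (e : bool) x := upd x j (x j + (if e then 1 else -1)).

Definition flip (Q : pred nat) x : gridpt := fun i => if Q i then - x i else x i.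

Definition below y x :=
  forall i, y i = x i \/ oddz (x i) /\ (y i = x i + 1 \/ y i = x i - 1).

Lemma updE x j v : upd x j v j = v. Proof. by rewrite /upd eqxx. Qed.

Lemma upd_neq x j v i : i != j -> upd x j v i = x i.
Proof. by rewrite /upd => /negbTE ->. Qed.

Lemma updC x i j u v : i != j -> upd (upd x i u) j v = upd (upd x j v) i u.
Proof.
move=> ij; apply: funext => l; rewrite /upd.
by case: (eqVneq l j) => // ->; rewrite eq_sym (negbTE ij).
Qed.

Lemma upd_upd x j u v : upd (upd x j u) j v = upd x j v.
Proof. by apply: funext => l; rewrite /upd; case: eqP. Qed.

Lemma oddz_step (v : int) e : oddz (v + (if e then 1 else -1)) = ~~ oddz v.
Proof. by rewrite /oddz; case: e; lia. Qed.

Lemma step_neq j e x i : i != j -> step j e x i = x i.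
Proof. exact: upd_neq. Qed.

Lemma stepC i j e f x : i != j -> step j f (step i e x) = step i e (step j f x).
Proof.
move=> ij; rewrite /step updC // [upd x _ _ j]upd_neq 1?eq_sym //.
by rewrite [upd x _ _ i]upd_neq.
Qed.

Lemma flip_step Q j e x : flip Q (step j e x) = step j (e (+) Q j) (flip Q x).
Proof.
apply: funext => i; rewrite /flip /step /upd.
case: (eqVneq i j) => [->|//]; case: (Q j); rewrite ?addbF //.
by case: e; rewrite /= opprD ?opprK.
Qed.

Lemma below_refl x : below x x. Proof. by left. Qed.

Lemma below_trans y x z : below z y -> below y x -> below z x.
Proof.
move=> zy yx i; case: (zy i) (yx i) => [->//|[oy _]].
case=> [<-|[ox yi]]; first exact: zy.
move: oy; case: yi => ->; first by rewrite (oddz_step _ true) ox.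
by rewrite (oddz_step _ false) ox.
Qed.

Lemma step_below j e x : oddz (x j) -> below (step j e x) x.
Proof.
move=> ox i; rewrite /step /upd; case: eqP => [->|]; last by left.
by right; split=> //; case: e; [left|right].
Qed.

Variable m : nat.

Definition cobd B x : 'F_2 :=
  \sum_(j < m | oddz (x j)) \sum_(e : bool) B (step j e x).

Lemma cobdD B B' x : cobd (fun y => B y + B' y) x = cobd B x + cobd B' x.
Proof. by rewrite -big_split; apply: eq_bigr => j _; rewrite big_split. Qed.

Lemma cobdZ c B x : cobd (fun y => c * B y) x = c * cobd B x.
Proof. by rewrite mulr_sumr; apply: eq_bigr => j _; rewrite mulr_sumr. Qed.

Lemma eq_cobd B B' x :
  (forall j e, oddz (x j) -> B (step j e x) = B' (step j e x)) ->
  cobd B x = cobd B' x.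
Proof.
by move=> BB'; apply: eq_bigr => j ox; apply: eq_bigr => e _; exact: BB'.
Qed.

Lemma cobd_flip Q B x : cobd B (flip Q x) = cobd (B \o flip Q) x.
Proof.
apply: eq_big => [j|j ox]; first by rewrite /flip /oddz; case: ifP; rewrite ?abszN.
rewrite (reindex_inj (can_inj (addbK (Q j)))).
by apply: eq_bigr => e _; rewrite /= flip_step.
Qed.

(** A direction that has been left is no longer free, so the second step uses another one. Each face
    of codimension two is therefore reached twice, once for each order of its two directions. *)
Lemma cobd_cobd B x : cobd (cobd B) x = 0.
Proof.
pose G (i j : 'I_m) : 'F_2 := if [&& oddz (x i), oddz (x j) & i != j] then
   \sum_e \sum_f B (step j f (step i e x)) else 0.
rewrite -[RHS](@F2_sum_symmetric m G); first last.
- by move=> i; rewrite /G eqxx !andbF.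
- move=> i j; rewrite /G [j == i]eq_sym andbCA; case: ifP => // /and3P[_ _ ij].
  rewrite exchange_big; apply: eq_bigr => e _; apply: eq_bigr => f _.
  by rewrite stepC.
rewrite /cobd big_mkcond; apply: eq_bigr => i _ /=; case: ifP => oi; last first.
  by rewrite big1 // => j _; rewrite /G oi.
rewrite (eq_bigr _ (fun e _ => big_mkcond _ _)) exchange_big.
apply: eq_bigr => j _; rewrite /G oi /=.
case: (eqVneq j i) => [->|ji].
  by rewrite andbF big1 // => e _; rewrite /step updE oddz_step oi.
rewrite andbT; case: ifP => oj; last first.
  by rewrite big1 // => e _; rewrite step_neq ?oj.
by apply: eq_bigr => e _; rewrite step_neq ?oj.
Qed.

Variable s : nat -> gridpt -> bool.

(* The value at the centre of a cell of the cup product of the first [k] of the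
   cocycles [delta (s i)], in the order-preserving cubical cup product. *)
Fixpoint cup (k : nat) : gridpt -> 'F_2 :=
  if k is k'.+1 then cobd (fun x => (s k' x)%:R * cup k' x)
  else fun x => [forall i : 'I_m, ~~ oddz (x i)]%:R.

(** [cup 0] takes the same value on two opposite facets, and every later [cup k] is itself a
    coboundary. *)
Lemma cobd_cup k x : cobd (cup k) x = 0.
Proof.
case: k => [|k]; last exact: cobd_cobd.
rewrite /cobd big1 // => j _; rewrite big_bool /=.
suff -> : [forall i : 'I_m, ~~ oddz (step j true x i)] =
          [forall i : 'I_m, ~~ oddz (step j false x i)] by rewrite F2_addxx.
apply: eq_forallb => i; rewrite /step /upd; case: eqP => // _.
by rewrite (oddz_step _ true) (oddz_step _ false).
Qed.

(** The two sides differ by [s k x] times the coboundary of the cocycle [cup k]. Iterated, this form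
    shows that [cup k x] counts modulo 2 the flags: chains of [k] facet steps from [x] down to a
    vertex such that, for each [i < k], the sign [s i] changes at the step that is followed by [i]
    more. *)
Lemma cupS k x : cup k.+1 x =
  \sum_(j < m | oddz (x j)) \sum_(e : bool)
    (s k x (+) s k (step j e x))%:R * cup k (step j e x).
Proof.
transitivity (cobd (fun y => (s k x (+) s k y)%:R * cup k y) x); last by [].
rewrite -[LHS]add0r -(mulr0 (s k x)%:R) -(cobd_cup k x) -cobdZ -cobdD.
by apply: eq_cobd => j e _; rewrite F2_natr_addb mulrDl.
Qed.

(** A nonzero count leaves at least one flag, and all its members are faces of [x]. *)
Lemma cup_neq0 k x : cup k x != 0 -> forall i, (i < k)%N ->
  exists y z, [/\ below y x, below z x & s i y != s i z].
Proof.
elim: k x => // k IHk x; rewrite cupS => nz i; rewrite ltnS.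
have [j oj [e]] : exists2 j : 'I_m, oddz (x j) &
    exists e, (s k x (+) s k (step j e x))%:R * cup k (step j e x) != 0.
  apply: contraNP nz => /forall2NP nz; rewrite big1 // => j oj.
  rewrite big1 // => e _; have [//|/forallNP/(_ e)/negP] := nz j.
  by rewrite negbK => /eqP.
rewrite mulf_eq0 negb_or => /andP[sxy cy].
rewrite leq_eqVlt => /predU1P[->|ik].
  exists x, (step j e x); split; [exact: below_refl|exact: step_below|].
  by move: sxy; case: (s k x); case: (s k _).
have [y [z [yx zx syz]]] := IHk _ cy _ ik.
by exists y, z; split=> //; apply: below_trans (step_below _ oj).
Qed.

(** Here and below [K] is a family of cells closed under faces. Complementing [s k] adds the
    coboundary of the cocycle [cup k], which is zero, so a common change of all signs leaves the cup
    product as it is. *)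
Lemma cup_flip (K : gridpt -> Prop) (c : bool) Q k x :
    (forall y j e, K y -> oddz (y j) -> K (step j e y)) ->
    (forall i y, K y -> s i (flip Q y) = s i y (+) c) ->
  K x -> cup k (flip Q x) = cup k x.
Proof.
move=> Kstep sflip; elim: k x => [|k IHk] x Kx.
  congr (_%:R); apply: (congr1 nat_of_bool); apply: eq_forallb => i.
  by rewrite /flip /oddz; case: ifP; rewrite ?abszN.
rewrite /= cobd_flip -[RHS]addr0 -(mulr0 c%:R) -(cobd_cup k x) -cobdZ -cobdD.
apply: eq_cobd => j e oj; rewrite /= sflip ?IHk; [|exact: Kstep..].
by rewrite F2_natr_addb mulrDl.
Qed.

(** A flag from [x] to a vertex has to leave the free direction [l] at some step, and no sign
    changes there. *)
Lemma cup_degenerate (K : gridpt -> Prop) l k x :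
    (forall y j e, K y -> oddz (y j) -> K (step j e y)) ->
    (forall i e y, K y -> s i (step l e y) = s i y) ->
  (l < m)%N -> K x -> oddz (x l) -> cup k x = 0.
Proof.
move=> Kstep sl lm; elim: k x => [|k IHk] x Kx ol.
  rewrite [cup _ _](_ : _ = 0%:R) //; congr (_%:R); apply/eqP; rewrite eqb0.
  by apply/forallPn; exists (Ordinal lm); rewrite negbK.
rewrite cupS big1 // => j oj; rewrite big1 // => e _.
have [jl|jl] := eqVneq (j : nat) l; first by rewrite jl sl // addbb mul0r.
by rewrite IHk ?mulr0 //; [exact: Kstep|rewrite step_neq // eq_sym].
Qed.

(** The last step of a flag, from an edge to a vertex, would have to change [s 0]. *)
Lemma cup_const (K : gridpt -> Prop) b k x :
    (forall y j e, K y -> oddz (y j) -> K (step j e y)) ->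
    (forall y, K y -> s 0 y = b) ->
  K x -> cup k.+1 x = 0.
Proof.
move=> Kstep s0; elim: k x => [|k IHk] x Kx; rewrite cupS big1 // => j oj;
  rewrite big1 // => e _; have Ky := Kstep _ _ e Kx oj.
  by rewrite !s0 // addbb mul0r.
by rewrite IHk ?mulr0.
Qed.

End GridCochains.

(** * Sums over boxes of grid cells and their Stokes formula *)

Section BoxSums.
Variable M : nat.
Implicit Types (x y : gridpt) (B : gridpt -> 'F_2) (P : pred nat).

(** The grid subdivides [-M, M] into [M] edges of length 2; this is the midpoint of the [o]-th
    one. *)
Definition node (o : nat) : int := (2 * o + 1)%:Z - M%:Z.

Fixpoint boxsum P n B x : 'F_2 :=
  if n is n'.+1 then
    if P n' then \sum_(o < M) boxsum P n' B (upd x n' (node o))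
    else boxsum P n' B x
  else B x.

Lemma eq_boxsum P P' n B B' x x' :
    (forall i, (i < n)%N -> P i = P' i) ->
    (forall i, ~~ ((i < n)%N && P i) -> x i = x' i) ->
    (forall y, (forall i, (i < n)%N && P i -> exists2 o, (o < M)%N & y i = node o) ->
       (forall i, ~~ ((i < n)%N && P i) -> y i = x i) -> B y = B' y) ->
  boxsum P n B x = boxsum P' n B' x'.
Proof.
elim: n x x' => [|n IHn] x x' PP' xx' BB' /=.
  have -> : x = x' by apply: funext => i; exact: xx'.
  by apply: BB' => // i _; rewrite xx'.
rewrite -PP' //; case: ifP => Pn; [apply: eq_bigr => o _|]; apply: IHn.
- by move=> i /ltnW; exact: PP'.
- move=> i; rewrite /upd; case: eqP => // /eqP ni niP; apply: xx'.
  by apply: contra niP => /andP[]; rewrite ltnS leq_eqVlt (negbTE ni) => /= -> ->.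
- move=> y yP yx; apply: BB' => i; rewrite ltnS leq_eqVlt; case: eqP => [->|/eqP ni] /=.
  + by move=> _; exists o => //; rewrite yx ?updE // ltnn.
  + exact: yP.
  + by rewrite Pn.
  + by move=> niP; rewrite yx // upd_neq.
- by move=> i /ltnW; exact: PP'.
- move=> i niP; apply: xx'; apply: contra niP => /andP[].
  by rewrite ltnS leq_eqVlt; case: eqP => [->|_ /= -> ->//]; rewrite Pn.
- move=> y yP yx; apply: BB' => i; rewrite ltnS leq_eqVlt; case: eqP => [->|/eqP ni] /=.
  + by rewrite Pn.
  + exact: yP.
  + by rewrite yx // ltnn.
  + by move=> niP; rewrite yx.
Qed.

Lemma boxsum_eq0 P n B x :
    (forall y, (forall i, (i < n)%N && P i -> exists2 o, (o < M)%N & y i = node o) ->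
       (forall i, ~~ ((i < n)%N && P i) -> y i = x i) -> B y = 0) ->
  boxsum P n B x = 0.
Proof.
move=> B0; rewrite (@eq_boxsum P P n B (fun=> 0) x x) //.
by elim: n x {B0} => //= n IHn x; case: ifP => // _; rewrite big1.
Qed.

Lemma boxsum_sum (I : Type) (r : seq I) (Q : pred I) P n (B : I -> gridpt -> 'F_2) x :
  boxsum P n (fun y => \sum_(i <- r | Q i) B i y) x =
  \sum_(i <- r | Q i) boxsum P n (B i) x.
Proof.
elim: n x => //= n IHn x; case: ifP => // _.
by rewrite exchange_big; apply: eq_bigr => o _; rewrite IHn.
Qed.

Lemma boxsumD P n B B' x :
  boxsum P n (fun y => B y + B' y) x = boxsum P n B x + boxsum P n B' x.
Proof.
elim: n x => //= n IHn x; case: ifP => // _.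
by rewrite -big_split; apply: eq_bigr => o _; rewrite IHn.
Qed.

Lemma boxsum_pred0 n B x : boxsum pred0 n B x = B x.
Proof. by elim: n. Qed.

Lemma boxsum_upd P n B x j v : ~~ ((j < n)%N && P j) ->
  boxsum P n (fun y => B (upd y j v)) x = boxsum P n B (upd x j v).
Proof.
elim: n x => //= n IHn x; rewrite ltnS leq_eqVlt.
case: eqP => [jn /= /negbTE Pj|/eqP jn].
  by subst n; rewrite Pj IHn // ltnn.
rewrite orFb => njP; case: ifP => _; last exact: IHn.
by apply: eq_bigr => o _; rewrite IHn // updC // eq_sym.
Qed.

Lemma boxsum_split P n B x j : (j < n)%N -> P j ->
  boxsum P n B x = \sum_(o < M) boxsum (predD1 P j) n B (upd x j (node o)).
Proof.
elim: n x => //= n IHn x; rewrite ltnS leq_eqVlt => /predU1P[<- Pj|jn Pj].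
  rewrite Pj eqxx; apply: eq_bigr => o _; apply: eq_boxsum => // i ij.
  by rewrite /= (ltn_eqF ij).
rewrite eq_sym (ltn_eqF jn) /=; case: ifP => Pn; last exact: IHn.
rewrite (eq_bigr _ (fun o _ => IHn _ jn Pj)) exchange_big.
by apply: eq_bigr => o _; apply: eq_bigr => o' _; rewrite updC // neq_ltn jn orbT.
Qed.

Lemma boxsum_neq0 P n B x : boxsum P n B x != 0 ->
  exists y, [/\ B y != 0, forall i, (i < n)%N && P i -> exists2 o, (o < M)%N & y i = node o
              & forall i, ~~ ((i < n)%N && P i) -> y i = x i].
Proof.
apply: contraNP => /forallNP nB; apply/eqP/boxsum_eq0 => y yP yx.
by apply/eqP/negPn/negP => By; apply: (nB y).
Qed.

Lemma boxsum_flip P n B x Q :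
  boxsum P n B (flip Q x) = boxsum P n (B \o flip Q) x.
Proof.
elim: n x => //= n IHn x; case: ifP => // _.
rewrite [RHS](eq_bigr _ (fun o _ => esym (IHn _))).
case Qn: (Q n).
  (* [node] takes opposite values at [o] and at [M - 1 - o]. *)
  rewrite (reindex_inj rev_ord_inj); apply: eq_bigr => o _; congr boxsum.
  apply: funext => i; rewrite /flip /upd; case: (eqVneq i n) => [->|//].
  rewrite Qn /node /=; have := ltn_ord o; lia.
apply: eq_bigr => o _; congr boxsum.
by apply: funext => i; rewrite /flip /upd; case: (eqVneq i n) => [->|//]; rewrite Qn.
Qed.

Hypothesis Meven : ~~ odd M.

Lemma oddz_node o : oddz (node o).
Proof. by rewrite /oddz /node; lia. Qed.

(** Stokes' formula: in each free direction the facets shared by consecutive cells cancel modulo 2,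
    which leaves the two ends -M and M. The coordinates held fixed are even, so they contribute no
    facets. *)
Lemma boxsum_cobd m P B x :
    (forall j, (j < m)%N -> ~~ P j -> ~~ oddz (x j)) ->
  boxsum P m (cobd m B) x =
  \sum_(0 <= j < m | P j) (boxsum (predD1 P j) m B (upd x j (- M%:Z)) +
                           boxsum (predD1 P j) m B (upd x j M%:Z)).
Proof.
move=> xP; rewrite [RHS]big_mkcond big_mkord [LHS](@eq_boxsum _ P _ _ (fun y =>
   \sum_(j < m) (if P j then \sum_e B (step j e y) else 0)) _ x) //; last first.
  move=> y yP yx; rewrite /cobd [LHS]big_mkcond; apply: eq_bigr => j _.
  case Pj: (P j).
    by have [|o _ ->] := yP j; rewrite ?ltn_ord // oddz_node.
  by rewrite yx ?Pj ?andbF // (negbTE (xP j _ _)) ?Pj.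
rewrite boxsum_sum; apply: eq_bigr => j _.
case: ifP => Pj; last exact: boxsum_eq0.
have nPj : ~~ ((j < m)%N && predD1 P j j) by rewrite /= eqxx andbF.
rewrite (boxsum_split _ _ _ Pj) //.
pose u o := boxsum (predD1 P j) m B (upd x j ((2 * o)%:Z - M%:Z)).
transitivity (\sum_(o < M) (u o + u o.+1)); last first.
  by rewrite F2_telescope /u; congr (boxsum _ _ _ _ + boxsum _ _ _ _);
     congr upd; lia.
apply: eq_bigr => o _.
rewrite -boxsum_upd //.
under eq_fun do rewrite big_bool /step !updE !upd_upd.
rewrite boxsumD !(boxsum_upd (fun y => B y)) // addrC /u.
by congr (boxsum _ _ _ _ + boxsum _ _ _ _); congr upd; rewrite /node; lia.
Qed.

End BoxSums.

(** * The cup product numbers of the blow-up *)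

Section BlowUp.
(* The coordinate 0 is the offset, the coordinates 1, ..., p parametrize [v] and the
   coordinates p+1, ..., p+q parametrize [(u0, w)]. *)
Variables (p q M : nat) (s : nat -> gridpt -> bool).
Hypotheses (Meven : ~~ odd M) (M_gt0 : (0 < M)%N).

Let m := (p + q).+1.
Let z : gridpt := fun=> M%:Z.

(* [later i l]: the coordinate [l] comes after [i] in the same block. *)
Definition later i l := (i < l)%N && ((l <= p)%N || (p < i)%N).

Hypothesis s_offset : forall x : gridpt,
  (x 0%N = M%:Z -> s 0%N x = false) /\ (x 0%N = - M%:Z -> s 0%N x = true).
(** In iterated join coordinates, a coordinate at the end of its interval makes the later ones of
    its block irrelevant. *)
Hypothesis s_later : forall k i (x y : gridpt), (0 < i < m)%N -> M%:Z <= `|x i| ->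
  (forall l, ~~ later i l -> x l = y l) -> s k x = s k y.
(** Here [v] lies on the rim of its half-sphere. Changing all signs negates [v], [w] and the offset
    and keeps [u0], so that (n, a) becomes (-n, -a). *)
Hypothesis s_antipode : forall k i (x : gridpt), (0 < i <= p)%N -> M%:Z <= `|x i| ->
  s k (flip (fun l => l < m)%N x) = ~~ s k x.
(** Here [(u0, w)] lies on its rim, so that u0 = 0 and n = (0, w): negating [w] and the offset is
    enough to get (-n, -a), with [v] kept. *)
Hypothesis s_half_antipode : forall k i (x : gridpt), (p < i < m)%N -> M%:Z <= `|x i| ->
  s k (flip (fun l => (l == 0) || (p < l < m))%N x) = ~~ s k x.

(** The free directions of the cell h(a, b); [z] holds the other coordinates at the end M. *)
Let J a b := fun i => ((i <= a) || (p < i <= p + b))%N.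
Let B k : gridpt -> 'F_2 := fun x => (s k x)%:R * cup m s k x.
Let W a b := boxsum M (J a b) m (cup m s (a + b).+1) z.

Let extremal (K : pred nat) (y : gridpt) := forall i, K i -> `|y i| = M%:Z.

Let extremal_even (v : int) : `|v| = M%:Z -> ~~ oddz v.
Proof. by rewrite -abszE /oddz => -[->]. Qed.

(** As [M] is even, an extremal coordinate is not a free direction, so the extremal cells are closed
    under faces. *)
Let extremal_step K y j e : extremal K y -> oddz (y j) -> extremal K (step j e y).
Proof.
move=> Ky oj i Ki; rewrite step_neq ?Ky //; apply: contraTneq oj => <-.
exact/extremal_even/Ky.
Qed.

Let facets (P : pred nat) (j k : nat) : 'F_2 :=
  boxsum M (predD1 P j) m (B k) (upd z j (- M%:Z)) +
  boxsum M (predD1 P j) m (B k) (upd z j M%:Z).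

Let facets_eq0 (P : pred nat) j k : (j < m)%N ->
    (forall y, extremal (pred1 j) y ->
       (forall i, (i < m)%N -> i != j -> P i -> oddz (y i)) -> cup m s k y = 0) ->
  facets P j k = 0.
Proof.
move=> jm c0; rewrite /facets !boxsum_eq0 ?addr0 // => y yP yz;
  rewrite /B c0 ?mulr0 //;
  try by (move=> i /eqP ->; rewrite yz ?updE ?normrN ?normr_nat //= eqxx andbF).
all: by move=> i im ij Pi; have [|o _ ->] := yP i; rewrite ?oddz_node //= im ij.
Qed.

(** At either end of the offset interval [s 0] is constant. *)
Let facets_offset (P : pred nat) k : facets P 0%N k.+1 = 0.
Proof.
apply: facets_eq0 => // y Ky _.
have [b sb] : exists b, forall x : gridpt, x 0%N = y 0%N -> s 0%N x = b.
  have := Ky 0%N (eqxx _); case: (leP 0 (y 0%N)) => y0.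
    by rewrite ger0_norm // => yM; exists false => x xy; apply: (s_offset x).1; rewrite xy.
  rewrite ltr0_norm // => yM; exists true => x xy; apply: (s_offset x).2.
  by rewrite xy -yM opprK.
apply: (@cup_const m s (fun x => x 0%N = y 0%N /\ extremal (pred1 0%N) x) b) => //.
- move=> x j e [x0 Kx] ox; split; last exact: extremal_step.
  rewrite step_neq //; apply: contraTneq ox => <-.
  exact/extremal_even/(Kx 0%N (eqxx _)).
- by move=> x [x0 _]; exact: sb.
Qed.

(** On these facets coordinate [j] is extremal, so the signs do not see the free direction [l]. *)
Let facets_later (P : pred nat) j l k : (0 < j < m)%N -> (l < m)%N -> P l -> later j l ->
  facets P j k = 0.
Proof.
move=> /andP[j0 jm] lm Pl jl; apply: facets_eq0 => // y Ky yP.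
have lj : l != j by move: jl; rewrite /later; lia.
apply: (@cup_degenerate m s (extremal (pred1 j)) l) => //; last exact: yP.
- by move=> x i e; exact: extremal_step.
- move=> k' e x Kx; apply: (@s_later _ j); rewrite ?j0 //.
    by rewrite step_neq ?Kx /= ?eqxx // eq_sym.
  by move=> i nji; rewrite step_neq //; apply: contraNneq nji => ->.
Qed.

(** The reflection carries one facet to the opposite one, preserves [cup k] and adds [c] to [s k].
    The two contributions, (s_k + c) cup_k and s_k cup_k, add up to c cup_k. *)
Let facets_flip (K : pred nat) c (Q P : pred nat) j k : (j < m)%N -> Q j ->
    (forall i, K i -> ~~ ((i < m)%N && predD1 P j i)) ->
    (forall i, Q i -> (i == j) || (i < m)%N && P i) ->
    (forall k' y, extremal K y -> s k' (flip Q y) = s k' y (+) c) ->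
  facets P j k = c%:R * boxsum M (predD1 P j) m (cup m s k) z.
Proof.
move=> jm Qj KP QP sflip; rewrite /facets.
have -> : upd z j M%:Z = z by apply: funext => i; rewrite /upd /z; case: eqP.
rewrite (@eq_boxsum M _ (predD1 P j) _ _ (B k) _ (flip Q z)) //; last first.
  move=> i niP; rewrite /flip /upd; case: eqP => [->|/eqP ij]; first by rewrite Qj.
  case Qi: (Q i) => //; move: niP; rewrite /= ij.
  by have := QP _ Qi; rewrite (negbTE ij) /= => ->.
rewrite boxsum_flip -boxsumD; case: c sflip => sflip; rewrite ?mul1r ?mul0r.
  apply: eq_boxsum => // y _ yz.
  have Ky : extremal K y by move=> i Ki; rewrite yz ?KP // normr_nat.
  rewrite /B /= sflip // (@cup_flip m s (extremal K) true Q k y) //.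
    by rewrite F2_natr_addb mulrDl addrAC F2_addxx add0r mul1r.
  by move=> x i e; exact: extremal_step.
apply: boxsum_eq0 => // y _ yz.
have Ky : extremal K y by move=> i Ki; rewrite yz ?KP // normr_nat.
rewrite /B /= sflip // (@cup_flip m s (extremal K) false Q k y) //.
  by rewrite addbF F2_addxx.
by move=> x i e; exact: extremal_step.
Qed.

Let W_facets a b : (a <= p)%N -> (b <= q)%N ->
  W a b = \sum_(0 <= j < m | J a b j) facets (J a b) j (a + b).
Proof.
by move=> ap bq; apply: boxsum_cobd => // j _ _; rewrite /z /oddz absz_nat.
Qed.

Let W00 : W 0%N 0%N = 1.
Proof.
rewrite W_facets // big_mkcond /= big_nat_recl // big1_seq ?addr0; last first.
  by move=> i _; case: ifP => //; rewrite /J; lia.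
have E : (predD1 (J 0%N 0%N) 0%N : pred nat) = pred0 by apply: funext => i /=; rewrite /J; lia.
rewrite /facets E !boxsum_pred0 /B.
have -> : s 0%N (upd z 0%N (- M%:Z)) by apply: (s_offset _).2; rewrite updE.
have -> : s 0%N (upd z 0%N M%:Z) = false by apply: (s_offset _).1; rewrite updE.
rewrite mul1r mul0r addr0 /=.
have -> // : [forall i : 'I_m, ~~ oddz (upd z 0%N (- M%:Z) i)].
by apply/forallP => i; rewrite /upd /z /oddz; case: eqP => _; rewrite ?abszN absz_nat.
Qed.

(** For b = q the antipode identifies the two facets and reverses all signs; the coordinates after
    [a.+1] in the first block may be flipped or not, by [s_later]. *)
Let facetT a b : (a < p)%N -> (b <= q)%N ->
  facets (J a.+1 b) a.+1 (a.+1 + b) = if b == q then W a b else 0.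
Proof.
move=> ap bq.
have E : (predD1 (J a.+1 b) a.+1 : pred nat) = J a b by apply: funext => i /=; rewrite /J; lia.
case: eqP => bq'.
  rewrite (@facets_flip (pred1 a.+1) true (fun i => (i <= a.+1)%N || (p < i < m)%N)).
  - by rewrite mul1r E.
  - by rewrite /m; lia.
  - by rewrite leqnn.
  - by move=> i /eqP ->; rewrite /= eqxx andbF.
  - by move=> i; rewrite /J /m; lia.
  - move=> k' y Ky; rewrite addbT.
    have yM := Ky _ (eqxx a.+1).
    rewrite -(@s_antipode _ a.+1) ?yM //; apply: (@s_later _ a.+1).
    + by rewrite /m; lia.
    + by rewrite /flip leqnn normrN yM.
    + move=> l nl; rewrite /flip; congr (if _ then _ else _).
      by move: nl; rewrite /later /m; lia.
(* For b < q the coordinate [p + q] is held at its end. The antipode and the half antipode then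
   compose to a reflection of the first block alone, which preserves the signs, so the two facets
   cancel. *)
rewrite (@facets_flip (pred2 a.+1 (p + q)) false (fun i => (0 < i <= a.+1)%N)).
- by rewrite mul0r.
- by rewrite /m; lia.
- by rewrite ltnS leqnn.
- by move=> i /orP[] /eqP ->; rewrite /= ?eqxx ?andbF // /J /m; lia.
- by move=> i; rewrite /J /m; lia.
- move=> k' y Ky; rewrite addbF; apply: negb_inj.
  have yM : `|y a.+1| = M by apply: Ky; rewrite /= eqxx.
  have yM' : `|y (p + q)%N| = M by apply: Ky; rewrite /= eqxx orbT.
  rewrite -(@s_antipode _ a.+1 y) ?yM // -(@s_half_antipode _ (p + q)%N).
  + apply: (@s_later _ a.+1).
    * by rewrite /m; lia.
    * by rewrite /flip; do 2![case: ifP => _]; rewrite ?normrN yM.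
    * move=> l nl; rewrite /flip.
      do 3![case: ifP]; rewrite ?opprK //; move: nl; rewrite /later /m; lia.
  + by rewrite /m; lia.
  + rewrite /flip; case: ifP => _; by rewrite ?normrN yM'.
Qed.

(** The half antipode identifies these two facets and reverses all signs. *)
Let facetS a b : (a <= p)%N -> (b < q)%N ->
  facets (J a b.+1) (p + b.+1) (a + b.+1) = W a b.
Proof.
move=> ap bq.
have E : (predD1 (J a b.+1) (p + b.+1)%N : pred nat) = J a b.
  by apply: funext => i /=; rewrite /J; lia.
rewrite (@facets_flip (pred1 (p + b.+1)%N) true
                      (fun i => (i == 0)%N || (p < i <= p + b.+1)%N)).
- by rewrite mul1r E /W addnS.
- by rewrite /m; lia.
- by rewrite /=; lia.
- by move=> i /eqP ->; rewrite /= eqxx andbF.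
- by move=> i; rewrite /J /m; lia.
- move=> k' y Ky; rewrite addbT.
  have yM := Ky _ (eqxx (p + b.+1)%N).
  rewrite -(@s_half_antipode _ (p + b.+1)%N) ?yM //; last by rewrite /m; lia.
  apply: (@s_later _ (p + b.+1)%N).
  + by rewrite /m; lia.
  + by rewrite /flip; case: ifP; rewrite ?normrN yM.
  + move=> l nl; rewrite /flip; congr (if _ then _ else _).
    by move: nl; rewrite /later /m; lia.
Qed.

(** Only the last free direction of each block can contribute: the offset facets vanish by
    [facets_offset], and any other direction has a later free one in its block. *)
Let W_rec a b : (a <= p)%N -> (b <= q)%N -> (0 < a + b)%N ->
  W a b = (if (0 < a)%N && (b == q) then W a.-1 b else 0) +
          (if (0 < b)%N then W a b.-1 else 0).
Proof.
move=> ap bq; case: a ap => [|a] ap.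
  case: b bq => // b bq _; rewrite W_facets // add0r.
  rewrite big_mkcond (bigD1_seq (p + b.+1)%N) ?iota_uniq //=; last first.
    by rewrite mem_index_iota /m; lia.
  rewrite ifT; last by rewrite /J; lia.
  rewrite facetS // big1_seq ?addr0 // => j /andP[jb].
  rewrite mem_index_iota => /= jm; case: ifP => // Jj.
  have [->|j0] := posnP j; first exact: facets_offset.
  by apply: (@facets_later _ _ j.+1); move: Jj; rewrite /J /later /m; lia.
move=> _; rewrite W_facets // big_mkcond (bigD1_seq a.+1) ?iota_uniq //=; last first.
  by rewrite mem_index_iota /m; lia.
rewrite ifT; last by rewrite /J; lia.
rewrite facetT //; congr (_ + _).
case: b bq => [|b] bq.
  rewrite big1_seq // => j /andP[ja].
  rewrite mem_index_iota => /= jm; case: ifP => // Jj.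
  have [->|j0] := posnP j; first exact: facets_offset.
  by apply: (@facets_later _ _ j.+1); move: Jj; rewrite /J /later /m; lia.
have pb : (p + b.+1)%N \in [seq i <- index_iota 0 m | i != a.+1].
  by rewrite mem_filter mem_index_iota /m; lia.
rewrite -big_filter (bigD1_seq _ pb) ?filter_uniq ?iota_uniq //.
rewrite ifT; last by rewrite /J; lia.
rewrite facetS // big1_seq => [|j /andP[jb]]; first exact: addr0.
rewrite mem_filter mem_index_iota => /andP[ja /= jm]; case: ifP => // Jj.
have [->|j0] := posnP j; first by rewrite addSn facets_offset.
by apply: (@facets_later _ _ j.+1); move: Jj; rewrite /J /later /m; lia.
Qed.

Let Wpq : W p q = 1.
Proof.
have W0 b : (b <= q)%N -> W 0 b = 1.
  elim: b => // b IHb bq; rewrite W_rec //= add0r IHb // ltnW //.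
(* For b < q the first term of the recursion is absent, so [W a b] descends to [W a 0], which has no
   term left. *)
have Wa a b : (0 < a <= p)%N -> (b < q)%N -> W a b = 0.
  move=> /andP[a0 ap]; elim: b => [|b IHb] bq.
    by rewrite W_rec ?addn0 // (ltn_eqF bq) andbF addr0.
  rewrite W_rec ?(ltnW bq) ?addnS // (ltn_eqF bq) andbF add0r.
  by rewrite IHb // ltnW.
suff Wq a : (a <= p)%N -> W a q = 1 by exact: Wq.
elim: a => [|a IHa] ap; first exact: W0.
rewrite W_rec // eqxx /= IHa ?(ltnW ap) //.
case: ifP => q0; rewrite ?addr0 // Wa ?addr0 //; lia.
Qed.

Lemma grid_sign_changes : exists x : gridpt,
  (forall i, `|x i| <= M%:Z) /\
  forall k, (k < m)%N -> exists y y', [/\ below y x, below y' x & s k y != s k y'].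
Proof.
have : W p q != 0 by rewrite Wpq oner_eq0.
case/boxsum_neq0 => x [cx xJ xz]; exists x; split.
  move=> i; case Ji : ((i < m)%N && J p q i); last by rewrite xz ?Ji /z.
  by have [l lM ->] := xJ _ Ji; rewrite /node; lia.
by move=> k km; exact: cup_neq0 cx _ km.
Qed.

End BlowUp.

(** * A Borsuk-Ulam theorem for the blow-up of a sphere *)

Section FirstNonzero.
Implicit Types (v w : seq int).

Definition lexpos v := 0 <= head 0 [seq a <- v | a != 0].

Lemma lexpos_cat v w : has (predC1 0) v -> lexpos (v ++ w) = lexpos v.
Proof.
rewrite /lexpos filter_cat has_filter.
by case: [seq a <- v | a != 0] (@erefl _ [seq a <- v | predC1 0 a]) => // <-.
Qed.

Lemma lexpos_opp v : has (predC1 0) v -> lexpos [seq - a | a <- v] = ~~ lexpos v.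
Proof.
elim: v => //= a v IHv; rewrite /lexpos /= oppr_eq0.
by case: eqP => [//|/eqP a0 _ /=]; rewrite oppr_ge0 -ltNge lt_neqAle a0.
Qed.

Lemma eq_lexpos_cat (x y : nat -> int) (l1 l2 : seq nat) i :
    i \in l1 -> x i != 0 -> {in l1, x =1 y} ->
  lexpos [seq x j | j <- l1 ++ l2] = lexpos [seq y j | j <- l1 ++ l2].
Proof.
move=> il xi xy; have yi : y i != 0 by rewrite -xy.
rewrite !map_cat !lexpos_cat ?(eq_in_map _ _ _).1 //.
  by congr lexpos; apply/eq_in_map.
all: by apply/hasP; eexists; [apply: map_f il|].
Qed.

End FirstNonzero.

Section BorsukUlamBlowUp.
Context (R : realType) (p q : nat).
Let m := (p + q).+1.
Variable g : 'I_m -> 'rV[R]_m -> R.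
Hypothesis g_continuous : forall k, continuous (g k).
Hypothesis g_offset : forall x : 'rV[R]_m,
  (1 <= x ord0 ord0 -> g ord0 x < 0) /\ (x ord0 ord0 <= -1 -> 0 < g ord0 x).
Hypothesis g_later : forall k (i : 'I_m) (x y : 'rV[R]_m), (0 < i)%N -> 1 <= `|x ord0 i| ->
  (forall l : 'I_m, ~~ later p i l -> x ord0 l = y ord0 l) -> g k x = g k y.
Hypothesis g_antipode : forall k (i : 'I_m) (x : 'rV[R]_m), (0 < i <= p)%N ->
  1 <= `|x ord0 i| ->
  g k (- x) = - g k x.
Hypothesis g_half_antipode : forall k (i : 'I_m) (x : 'rV[R]_m), (p < i)%N ->
  1 <= `|x ord0 i| ->
  g k (\row_l (if (l == 0 :> nat) || (p < l)%N then - x ord0 l else x ord0 l)) = - g k x.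

Let scaled (M : nat) (x : gridpt) : 'rV[R]_m := \row_i ((x i)%:~R / M%:R).

(* At a zero of [g k] the sign is that of the first nonzero coordinate, which has
   the symmetries of [g k]. *)
Let sgn M k x :=
  if g (inord k) (scaled M x) == 0 then
    lexpos [seq x i | i <- iota p.+1 q ++ iota 1 p]
  else 0 < g (inord k) (scaled M x).

Let sgnN M k x y : g (inord k) (scaled M y) = - g (inord k) (scaled M x) ->
    lexpos [seq y i | i <- iota p.+1 q ++ iota 1 p] =
      ~~ lexpos [seq x i | i <- iota p.+1 q ++ iota 1 p] ->
  sgn M k y = ~~ sgn M k x.
Proof.
move=> gy ly; rewrite /sgn gy ly oppr_eq0; case: eqP => // /eqP g0.
by rewrite oppr_gt0 -leNgt le_eqVlt (negbTE g0).
Qed.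

Let scaled_ge1 M (x : gridpt) (i : 'I_m) : (0 < M)%N -> M%:Z <= `|x i| ->
  1 <= `|scaled M x ord0 i|.
Proof.
move=> M0 xM; rewrite mxE normrM normfV normr_nat ler_pdivlMr ?ltr0n // mul1r.
by rewrite -intr_norm -[M%:R]/(M%:~R) ler_int.
Qed.

Lemma sgn_changes M : (0 < M)%N -> ~~ odd M -> exists x : gridpt,
  (forall i, `|x i| <= M%:Z) /\
  forall k, (k < m)%N ->
    exists y y', [/\ below y x, below y' x & sgn M k y != sgn M k y'].
Proof.
move=> M0 Me; apply: (@grid_sign_changes p q M (sgn M)) => //.
- move=> x; have sx : scaled M x ord0 ord0 = (x 0%N)%:~R / M%:R by rewrite mxE.
  have M0' : M%:R != 0 :> R by rewrite pnatr_eq0 -lt0n.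
  have i0 : inord 0 = ord0 :> 'I_m by apply: val_inj; rewrite /= inordK.
  rewrite /sgn i0; split=> x0; have [g1 gN1] := g_offset (scaled M x).
    have : g ord0 (scaled M x) < 0 by apply: g1; rewrite sx x0 divff.
    by move=> gx; rewrite (lt_eqF gx) ltNge ltW.
  have : 0 < g ord0 (scaled M x) by apply: gN1; rewrite sx x0 mulrNz mulNr divff.
  by move=> gx; rewrite (gt_eqF gx) gx.
- move=> k i x y /andP[i0 im] xM xy.
  have xi0 : x i != 0 by apply: contraTneq xM => ->; rewrite normr0; lia.
  rewrite /sgn (@g_later _ (Ordinal im) (scaled M x) (scaled M y)) //; first last.
  + by move=> l nl; rewrite !mxE xy.
  + by apply: scaled_ge1.
  congr (if _ then _ else _); have [ip|pi] := leqP i p.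
    have -> : iota 1 p = iota 1 i ++ iota i.+1 (p - i).
      by rewrite -[in LHS](subnKC ip) iotaD.
    rewrite !catA; apply: (@eq_lexpos_cat _ _ _ _ i) => //.
      by rewrite mem_cat !mem_iota; lia.
    by move=> l; rewrite mem_cat !mem_iota => li; apply: xy; rewrite /later; lia.
  have -> : iota p.+1 q = iota p.+1 (i - p) ++ iota i.+1 (q - (i - p)).
    have -> : iota i.+1 (q - (i - p)) = iota (p.+1 + (i - p)) (q - (i - p)).
      by congr iota; lia.
    by rewrite -iotaD subnKC //; lia.
  rewrite -!catA; apply: (@eq_lexpos_cat _ _ _ _ i) => //.
    by rewrite mem_iota; lia.
  by move=> l; rewrite mem_iota => li; apply: xy; rewrite /later; lia.
- move=> k i x /andP[i0 ip] xM.
  have xi0 : x i != 0 by apply: contraTneq xM => ->; rewrite normr0; lia.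
  have im : (i < m)%N by rewrite /m; lia.
  apply: sgnN.
    rewrite -(@g_antipode _ (Ordinal im)) ?i0 //; last exact: scaled_ge1.
    congr g; apply/rowP => l; rewrite !mxE /flip ltn_ord mulrNz mulNr.
    by [].
  rewrite -lexpos_opp; last first.
    apply/hasP; exists (x i) => //; apply: map_f.
    by rewrite mem_cat !mem_iota; lia.
  rewrite -map_comp; congr lexpos; apply/eq_in_map => l.
  by rewrite mem_cat !mem_iota /flip /= => ?; rewrite ifT // /m; lia.
- move=> k i x /andP[pi im] xM.
  have xi0 : x i != 0 by apply: contraTneq xM => ->; rewrite normr0; lia.
  apply: sgnN.
    rewrite -(@g_half_antipode _ (Ordinal im)) //; last exact: scaled_ge1.
    congr g; apply/rowP => l; rewrite !mxE /flip ltn_ord andbT.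
    by case: ifP => _; rewrite // mulrNz mulNr.
  (* The second block leads the tie-breaking list. It contains the nonzero coordinate [i], so it
     decides the sign alone, and the half antipode negates all of it while leaving the first block
     as it is. *)
  have nz (y : gridpt) : y i != 0 -> has (predC1 0) [seq y j | j <- iota p.+1 q].
    move=> yi; apply/hasP; exists (y i) => //; apply: map_f.
    by rewrite mem_iota; lia.
  rewrite !map_cat !lexpos_cat ?nz //; last first.
    by rewrite /flip pi im orbT oppr_eq0.
  rewrite -lexpos_opp ?nz // -map_comp; congr lexpos; apply/eq_in_map => l.
  by rewrite mem_iota /flip /= => ?; rewrite ifT // /m; lia.
Qed.

Let cell_sign M (x : 'rV[R]_m) := exists k, forall y y' : 'rV[R]_m,
  (forall i, `|y ord0 i - x ord0 i| <= M%:R^-1) ->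
  (forall i, `|y' ord0 i - x ord0 i| <= M%:R^-1) -> 0 < g k y * g k y'.

Let cell_sign_near x k : g k x != 0 ->
  \forall x' \near x & M \near \oo, cell_sign M x'.
Proof.
move=> gx.
have : \forall y \near x, 0 < g k x * g k y.
  have gg : (fun y => g k x * g k y) @ x --> g k x * g k x.
    exact: (cvgM (cvg_cst (g k x)) (@g_continuous k x)).
  apply: (gg [set v | 0 < v]); apply: open_nbhs_nbhs; split; first exact: open_gt.
  by rewrite /= -expr2 exprn_even_gt0.
move=> /nbhs_ballP[e /= e0 xe].
near=> x' M; exists k.
have M2 : M%:R^-1 < e / 2.
  have Mgt : (2 / e) < M%:R by near: M; exact: nbhs_infty_gtr.
  have M0 : 0 < M%:R :> R by apply: lt_trans Mgt; rewrite divr_gt0.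
  by rewrite invf_plt ?posrE ?divr_gt0 // invf_div.
have xx' : ball x (e / 2) x' by near: x'; apply: nbhsx_ballx; rewrite divr_gt0.
have gpos (y : 'rV[R]_m) : (forall i, `|y ord0 i - x' ord0 i| <= M%:R^-1) -> 0 < g k x * g k y.
  move=> yx'; apply: xe; split=> // i j; rewrite ord1.
  have := xx'.2 ord0 j; rewrite /ball /= => xx'j.
  have := yx' j => yx'j; rewrite distrC.
  rewrite (_ : y ord0 j - x ord0 j =
    (y ord0 j - x' ord0 j) + (x' ord0 j - x ord0 j)); last by ring.
  apply: le_lt_trans (ler_normD _ _) _; rewrite [ltRHS]splitr.
  by apply: ltrD; [exact: le_lt_trans M2|rewrite distrC].
move=> y y' /gpos gy /gpos gy'.
have := mulr_gt0 gy gy'; rewrite mulrACA -expr2 pmulr_rgt0 //.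
by rewrite exprn_even_gt0.
Unshelve. all: by end_near. Qed.

(** Without a common zero, around each point some [g k] keeps its sign on all small cubes. By
    compactness one mesh serves the whole cube [-1, 1]^m, which contradicts the existence of a cell
    where every sign changes. *)
Lemma borsuk_ulam_blowup : exists x, forall k, g k x = 0.
Proof.
apply: contrapT => /forallNP g_neq0.
have cpt : compact [set x : 'rV[R]_m | forall i, `[(-1 : R), 1]%classic (x ord0 i)].
  by apply: (@rV_compact _ _ (fun=> `[(-1 : R), 1]%classic)) => i; exact: segment_compact.
move/compact_near_coveringP: cpt => /(_ nat \oo cell_sign _) cov.
have [N _ sameN] : \forall M \near \oo,
    [set x : 'rV[R]_m | forall i, `[(-1 : R), 1]%classic (x ord0 i)] `<=` cell_sign M.
  apply: cov => x _; have /existsNP[k /eqP gkx] := g_neq0 x.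
  exact: cell_sign_near gkx.
(* Even and positive, as the grid requires, and at least [N]. *)
pose M := N.+1.*2.
have M0 : (0 < M)%N by rewrite /M; lia.
have [|x [xM xs]] := sgn_changes M0; first by rewrite odd_double.
have [|i|k ksame] := sameN M _ (scaled M x).
- by rewrite /M /=; lia.
- rewrite /= in_itv /= -ler_norml mxE normrM normfV normr_nat.
  by rewrite ler_pdivrMr ?ltr0n // mul1r -intr_norm -[M%:R]/(M%:~R) ler_int.
have [y [y' [yx y'x]]] := xs k (ltn_ord k).
have close (z : gridpt) : below z x ->
    forall i, `|scaled M z ord0 i - scaled M x ord0 i| <= M%:R^-1.
  move=> zx i; rewrite !mxE -mulrBl -intrB normrM normfV normr_nat.
  rewrite ler_piMl ?invr_ge0 // -intr_norm -[1]/(1%:~R) ler_int.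
  by case: (zx i) => [|[_ []]] ->; lia.
have := ksame _ _ (close _ yx) (close _ y'x).
rewrite /sgn !inord_val; set a := g k _; set b := g k _ => ab.
(* The positive product excludes zeros, so [sgn] is the true sign at both points. *)
have /andP[a0 b0] : (a != 0) && (b != 0).
  by rewrite -negb_or -mulf_eq0 gt_eqF.
rewrite (negbTE a0) (negbTE b0); apply/negP; rewrite negbK; apply/eqP.
apply/idP/idP => h; first by rewrite -(pmulr_rgt0 _ h).
by rewrite -(pmulr_lgt0 _ h).
Qed.

End BorsukUlamBlowUp.

(** * Continuity of mass assignments on half-spaces *)

Section LebesgueNull.
Context (R : realType).

Lemma lebesgue_rV0 n : @lebesgue_rV R n set0 = 0%E.
Proof.
elim: n => [|n IHn] /=; first by rewrite indic0.
by rewrite integral0_eq // => x _; rewrite -[RHS]IHn.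
Qed.

(** By slices along the first coordinate: if the rest [v1] of the normal is nonzero, each slice lies
    in a hyperplane of one dimension less; otherwise only the slice at b / v0 can be nonempty, and a
    single point is null for the outer integral. *)
Lemma lebesgue_rV_subhyperplane n (v : 'rV[R]_n) b (A : set 'rV[R]_n) :
  v != 0 -> A `<=` [set y | (y *m v^T) 0 0 = b] -> lebesgue_rV A = 0%E.
Proof.
elim: n => [|n IHn] in v b A *; first by rewrite thinmx0 eqxx.
pose v0 := lsubmx (v : 'rV_(1 + n)); pose v1 := rsubmx (v : 'rV_(1 + n)).
have vE : v = row_mx v0 v1 :> 'rV_(1 + n) by rewrite hsubmxK.
move=> vn0 Ab /=.
have Ax x y : A (row_mx x%:M y : 'rV_(1 + n)) -> x * v0 0 0 + (y *m v1^T) 0 0 = b.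
  have E : (row_mx x%:M y *m (row_mx v0 v1)^T) 0 0 = x * v0 0 0 + (y *m v1^T) 0 0.
    by rewrite tr_row_mx mul_row_col mxE mul_scalar_mx !mxE.
  by move=> /Ab /= <-; rewrite vE -E.
have [v10|v1n0] := eqVneq v1 0; last first.
  rewrite integral0_eq // => x _.
  by apply: (IHn v1 (b - x * v0 0 0)) => // y /Ax /= <-; ring.
rewrite integral_mkcond /= integral_mkcond.
have v00 : v0 0 0 != 0.
  apply: contra_neq vn0 => v00; rewrite vE v10 (mx11_scalar v0) v00.
  by rewrite raddf0 row_mx0.
rewrite -(@integral_Sset1 _ (fun x => lebesgue_rV [set y | A (row_mx x%:M y : 'rV_(1 + n))])
   [set b / v0 0 0] (b / v0 0 0)) // [RHS]integral_mkcond.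
apply: eq_integral => x _; rewrite !patchE !in_setT; case: ifPn => // xb.
rewrite (_ : mkset _ = set0) ?lebesgue_rV0 // -subset0 => y /= /Ax.
rewrite v10 trmx0 mulmx0 [X in _ + X]mxE addr0 => xv; move: xb; rewrite notin_setE /=; apply.
by rewrite -xv mulfK.
Qed.

End LebesgueNull.

(** * Continuity of matrix operations *)

Section MatrixContinuity.
Context (R : realType) (X : topologicalType).

Lemma continuousT_add (f g : X -> R) :
  continuous f -> continuous g -> continuous (fun x => f x + g x).
Proof. by move=> cf cg x; apply: (cvgD (cf x) (cg x)). Qed.

Lemma continuousT_sub (f g : X -> R) :
  continuous f -> continuous g -> continuous (fun x => f x - g x).
Proof. by move=> cf cg x; apply: (cvgB (cf x) (cg x)). Qed.

Lemma continuousT_mul (f g : X -> R) :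
  continuous f -> continuous g -> continuous (fun x => f x * g x).
Proof. by move=> cf cg x; apply: (cvgM (cf x) (cg x)). Qed.

Lemma mx_continuous m n (f : X -> 'M[R]_(m, n)) :
  (forall i j, continuous (fun x => f x i j)) -> continuous f.
Proof.
move=> cf x; apply/cvg_ballP => e e0.
have : \forall y \near x, forall i j, ball (f x i j) e (f y i j).
  apply: filter_forall => i; apply: filter_forall => j.
  by move/cvg_ballP: (cf i j x); exact.
by apply: filterS => y fxy; split.
Qed.

Lemma continuous_coord m n (f : X -> 'M[R]_(m, n)) i j :
  continuous f -> continuous (fun x => f x i j).
Proof. by move=> cf x; exact: (continuous_comp (cf x) (@coord_continuous _ m n i j _)). Qed.

Lemma sum_continuous (I : Type) (r : seq I) (F : I -> X -> R) :
  (forall i, continuous (F i)) -> continuous (fun x => \sum_(i <- r) F i x).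
Proof.
move=> cF; elim: r => [|i r IHr].
  under eq_fun do rewrite big_nil.
  exact: cst_continuous.
under eq_fun do rewrite big_cons.
exact: continuousT_add.
Qed.

Lemma mulmx_continuous m n l (f : X -> 'M[R]_(m, n)) (g : X -> 'M[R]_(n, l)) :
  continuous f -> continuous g -> continuous (fun x => f x *m g x).
Proof.
move=> cf cg; apply: mx_continuous => i j.
under eq_fun do rewrite mxE.
by apply: sum_continuous => k; apply: continuousT_mul; exact: continuous_coord.
Qed.

Lemma trmx_continuous m n (f : X -> 'M[R]_(m, n)) :
  continuous f -> continuous (fun x => (f x)^T).
Proof.
move=> cf; apply: mx_continuous => i j; under eq_fun do rewrite mxE.
exact: continuous_coord.
Qed.

End MatrixContinuity.

Section BorelRV.
Context (R : realType) (d : nat).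

Lemma open_borel (A : set 'rV[R]_d) : open A -> measurable (A : set (borel_rV R d)).
Proof. by move=> oA; exact: sub_sigma_algebra. Qed.

Lemma closed_borel (A : set 'rV[R]_d) : closed A -> measurable (A : set (borel_rV R d)).
Proof.
move=> /closed_openC oA; rewrite -(setCK A).
by apply: measurableC; exact: open_borel.
Qed.

Lemma continuous_borel (h : 'rV[R]_d -> R) :
  continuous h -> measurable_fun setT (h : borel_rV R d -> R).
Proof.
move=> /continuousP ch; apply: (measurability _ (RGenOpens.measurableE R)).
move=> _ [_ [a [b ->] <-]]; rewrite setTI; apply: open_borel.
exact/ch/interval_open.
Qed.

Lemma dot_continuous (n : 'rV[R]_d) : continuous (fun y : 'rV[R]_d => (y *m n^T) 0 0).
Proof.
apply: continuous_coord; apply: mulmx_continuous => x; first exact: cvg_id.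
exact: cst_continuous.
Qed.

Lemma closed_halfspace (n : 'rV[R]_d) a : closed [set y : 'rV[R]_d | a <= (y *m n^T) 0 0].
Proof.
have /continuous_closedP := @dot_continuous n.
by move=> /(_ [set v | a <= v]); apply; exact: closed_ge.
Qed.

Lemma closed_halfspace_le (n : 'rV[R]_d) a : closed [set y : 'rV[R]_d | (y *m n^T) 0 0 <= a].
Proof.
have /continuous_closedP := @dot_continuous n.
by move=> /(_ [set v | v <= a]); apply; exact: closed_le.
Qed.

End BorelRV.

(** * Null sets of a mass on a flat *)

Section MassNull.
Context (R : realType) (d k : nat) (V : flat R d k).

Lemma flat_closed : closed (flat_set V).
Proof.
case: V => _ [[x F] /= FF ->]; rewrite /flat_frames /= in FF.
(* Minus the orthogonal projection onto the complement of the row space of [F]; the flat is the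
   level set of y Q through [x]. *)
pose Q := F^T *m F - 1%:M.
have xcF c : (x + c *m F) *m Q = x *m Q.
  rewrite mulmxDl (_ : c *m F *m Q = 0) ?addr0 //.
  by rewrite /Q mulmxBr mulmx1 !mulmxA -(mulmxA c) FF mulmx1 subrr.
have -> : flat_span (x, F) =
    \bigcap_(i in [set: 'I_d]) [set y | (y *m Q) 0 i = (x *m Q) 0 i].
  apply/seteqP; split=> [_ [c _ <-] i _ /=|y /= yF]; first by rewrite xcF.
  exists ((y - x) *m F^T) => //=; rewrite -mulmxA.
  have /eqP : (y - x) *m Q = 0.
    by apply/eqP; rewrite mulmxBl subr_eq0; apply/eqP/rowP => i; exact: yF.
  by rewrite mulmxBr mulmx1 subr_eq0 => /eqP ->; rewrite addrC subrK.
apply: closed_bigI => i _.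
have cf : continuous (fun y : 'rV[R]_d => (y *m Q) 0 i).
  apply: continuous_coord; apply: mulmx_continuous => y; first exact: cvg_id.
  exact: cst_continuous.
move/continuous_closedP: cf => /(_ [set v | v = (x *m Q) 0 i]); apply.
exact: closed_eq.
Qed.

Lemma flat_frameE : flat_set V = flat_span (val (flat_frame V)).
Proof. exact: (s2valP' (cid2 (flatP V))). Qed.

Variable nu : mass V.

Lemma mass_off (A : set 'rV[R]_d) : measurable (A : set (borel_rV R d)) ->
  A `&` V = set0 -> nu A = 0%E.
Proof.
move=> mA AV; suff N0 : (flat_lebesgue V).-null_set A by apply: (mass_ac nu N0).
move=> B mB BA.
rewrite /flat_lebesgue (_ : mkset _ = set0) ?lebesgue_rV0 // -subset0 => c /BA Ac.
suff : (A `&` flat_set V) ((val (flat_frame V)).1 + c *m (val (flat_frame V)).2).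
  by rewrite AV.
by split=> //; rewrite flat_frameE; exists c.
Qed.

Lemma mass_on (A : set 'rV[R]_d) : measurable (A : set (borel_rV R d)) ->
  nu (V `&` A) = nu A.
Proof.
move=> mA; have mV := closed_borel flat_closed.
rewrite setIC -[X in _ = nu X](setUIDK A (flat_set V)) measureU //; first last.
- by rewrite setDE setIACA setICr setI0.
- exact: measurableD.
- exact: measurableI.
rewrite [X in (_ + X)%E](mass_off) ?adde0 //; first exact: measurableD.
by rewrite setDE -setIA setICl setI0.
Qed.

(** In the coordinates of the frame [F] of [V] the hyperplane has the normal n F^T, which is nonzero
    because [n] separates two points of [V]. *)
Lemma mass_hyperplane (n y y' : 'rV[R]_d) b : flat_set V y -> flat_set V y' ->
  (y *m n^T) 0 0 != (y' *m n^T) 0 0 -> nu [set y | (y *m n^T) 0 0 = b] = 0%E.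
Proof.
move=> Vy Vy' yy'.
have mA : measurable ([set y | (y *m n^T) 0 0 = b] : set (borel_rV R d)).
  apply: closed_borel; have /continuous_closedP := @dot_continuous R d n.
  by move=> /(_ [set v | v = b]); apply; exact: closed_eq.
suff N0 : (flat_lebesgue V).-null_set [set y | (y *m n^T) 0 0 = b].
  by apply: (mass_ac nu N0).
move=> B mB BA.
set x := (val (flat_frame V)).1; set F := (val (flat_frame V)).2.
have dotF (c : 'rV_k) : ((x + c *m F) *m n^T) 0 0 =
    (x *m n^T) 0 0 + (c *m (n *m F^T)^T) 0 0.
  by rewrite trmx_mul trmxK mulmxDl mulmxA mxE.
apply: (@lebesgue_rV_subhyperplane _ _ (n *m F^T) (b - (x *m n^T) 0 0)).
  apply: contra_neq yy' => nF; move: Vy Vy'.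
  rewrite flat_frameE => -[c _ <-] [c' _ <-].
  by rewrite !dotF nF trmx0 !mulmx0.
move=> c /BA Bc; apply: (addrI ((x *m n^T) 0 0)).
have {}Bc : ((x + c *m F) *m n^T) 0 0 = b := Bc.
by rewrite -dotF Bc [RHS]addrC subrK.
Qed.

End MassNull.

(** * Continuous cut-offs of half-spaces and of the region near infinity *)

Section CutOffs.
Context (R : realType).

Definition cut (v : R) := Num.min 1 (Num.max 0 v).

Lemma cut_bounds v : 0 <= cut v <= 1.
Proof. by rewrite /cut le_min ler01 le_max lexx ge_min lexx. Qed.

Lemma cut_eq1 v : 1 <= v -> cut v = 1.
Proof. by move=> v1; rewrite /cut min_l // le_max v1 orbT. Qed.

Lemma cut_eq0 v : v <= 0 -> cut v = 0.
Proof. by move=> v0; rewrite /cut max_l // min_r. Qed.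

Lemma cut_continuous (X : topologicalType) (h : X -> R) :
  continuous h -> continuous (fun x => cut (h x)).
Proof.
move=> ch x; apply: (@continuous_min R X (fun=> 1) (fun y => Num.max 0 (h y))).
  exact: cst_continuous.
by apply: (@continuous_max R X (fun=> 0) h); [exact: cst_continuous|exact: ch].
Qed.

Context (d : nat).

Lemma coord_le_norm (y : 'rV[R]_d) i : `|y 0 i| <= `|y|.
Proof.
by rewrite [leRHS]/Num.Def.normr /= mx_normrE; apply/bigmax_geP; right => /=; exists (0, i).
Qed.

(** The norm of row vectors is the sup norm, hence the factor [d]. *)
Lemma dot_le_norm (y n : 'rV[R]_d) : `|(y *m n^T) 0 0| <= d%:R * (`|y| * `|n|).
Proof.
rewrite mxE; apply: le_trans (ler_norm_sum _ _ _) _.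
apply: (@le_trans _ _ (\sum_(i < d) `|y| * `|n|)).
  by apply: ler_sum => i _; rewrite mxE normrM ler_pM // coord_le_norm.
by rewrite sumr_const card_ord mulr_natl.
Qed.

Definition tail (j : nat) (y : 'rV[R]_d) := cut (`|y| - j%:R).

(** For j > 0 it equals 1 where y . n >= a - 1/j and 0 where y . n <= a - 2/j. The constant 2 thus
    leaves a margin 1/j for moving the half-space. *)
Definition slab (n : 'rV[R]_d) a (j : nat) (y : 'rV[R]_d) :=
  cut (2 + j%:R * ((y *m n^T) 0 0 - a)).

Lemma tail_continuous j : continuous (tail j).
Proof.
apply/cut_continuous/continuousT_sub; last exact: cst_continuous.
exact: norm_continuous.
Qed.

Lemma slab_continuous n a j : continuous (slab n a j).
Proof.
apply/cut_continuous/continuousT_add; first exact: cst_continuous.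
apply: continuousT_mul; first exact: cst_continuous.
by apply: continuousT_sub; [exact: dot_continuous|exact: cst_continuous].
Qed.

(* Tends to the indicator of the closed half-space as [j] grows; the summand [tail]
   makes it dominate the indicators of all the nearby half-spaces as well. *)
Definition halfspace_cutoff n a j y := slab n a j y + tail j y.

Lemma halfspace_cutoff_continuous n a j : continuous (halfspace_cutoff n a j).
Proof.
by apply: continuousT_add; [exact: slab_continuous|exact: tail_continuous].
Qed.

Lemma halfspace_cutoff_bounds n a j y : 0 <= halfspace_cutoff n a j y <= 2.
Proof.
have /andP[s0 s1] := cut_bounds (2 + j%:R * ((y *m n^T) 0 0 - a)).
have /andP[t0 t1] := cut_bounds (`|y| - j%:R).
by rewrite /halfspace_cutoff /slab /tail; apply/andP; split; lra.
Qed.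

Lemma halfspace_cutoff_cvg n a y :
  halfspace_cutoff n a j y @[j --> \oo] --> (\1_[set y | a <= (y *m n^T) 0 0] y : R).
Proof.
apply: cvg_near_cst; near=> j; rewrite /halfspace_cutoff /slab /tail indicE.
have -> : cut (`|y| - j%:R) = 0.
  by apply: cut_eq0; rewrite subr_le0; near: j; exact: nbhs_infty_ger.
rewrite addr0; case: (leP a ((y *m n^T) 0 0)) => ay.
  rewrite mem_set // cut_eq1 //.
  by have : 0 <= j%:R * ((y *m n^T) 0 0 - a); [rewrite mulr_ge0 // subr_ge0|lra].
rewrite memNset /=; last by apply/negP; rewrite -ltNge.
apply: cut_eq0; have e0 : 0 < a - (y *m n^T) 0 0 by rewrite subr_gt0.
have : 2 / (a - (y *m n^T) 0 0) <= j%:R by near: j; exact: nbhs_infty_ger.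
by rewrite ler_pdivrMr // => ?; rewrite -opprB; lra.
Unshelve. all: by end_near. Qed.

End CutOffs.

Section FiniteMeasure.
Context (R : realType) (d : nat) (nu : {finite_measure set (borel_rV R d) -> \bar R}).

Lemma bounded_continuous_integrable (h : 'rV[R]_d -> R) :
  bounded_continuous h -> nu.-integrable setT (EFin \o (h : borel_rV R d -> R)).
Proof.
move=> [ch [M hM]]; apply: measurable_bounded_integrable => //.
- by rewrite -ge0_fin_numE //; exact: fin_num_measure.
- exact: continuous_borel.
- exists M; split; first exact: num_real.
  by move=> N MN y _ /=; exact: le_trans (hM y) (ltW MN).
Qed.

Lemma measure_le_integral (A : set 'rV[R]_d) (h : 'rV[R]_d -> R) :
    measurable (A : set (borel_rV R d)) -> bounded_continuous h ->
    (forall y, 0 <= h y) -> (forall y, A y -> 1 <= h y) ->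
  fine (nu A) <= \int[nu]_(y in [set: borel_rV R d]) h y.
Proof.
move=> mA bh h0 h1; rewrite -[A]setIT -(integral_indic nu measurableT) //.
apply: le_Rintegral => //; [exact: integrable_indic|exact: bounded_continuous_integrable|].
move=> y _; rewrite indicE; case: (boolP (y \in _)) => [/set_mem /h1|_] //.
Qed.

Lemma halfspace_cutoff_bounded n a j : bounded_continuous (@halfspace_cutoff R d n a j).
Proof.
split; first exact: halfspace_cutoff_continuous.
by exists 2 => y; have /andP[? ?] := halfspace_cutoff_bounds n a j y; rewrite ger0_norm.
Qed.

Lemma tail_bounded j : bounded_continuous (@tail R d j).
Proof.
split; first exact: tail_continuous.
by exists 1 => y; have /andP[? ?] := cut_bounds (`|y| - j%:R); rewrite ger0_norm.
Qed.

Lemma halfspace_cutoff_integral_cvg n a :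
  \int[nu]_(y in [set: borel_rV R d]) halfspace_cutoff n a j y @[j --> \oo] -->
  fine (nu [set y | a <= (y *m n^T) 0 0]).
Proof.
have mA : measurable ([set y | a <= (y *m n^T) 0 0] : set (borel_rV R d)).
  by apply: closed_borel; exact: closed_halfspace.
apply: fine_cvg; rewrite fineK ?fin_num_measure // -[X in nu X]setIT.
rewrite -(integral_indic nu measurableT) //.
apply: (@dominated_cvg _ _ _ nu _ measurableT _ _ (fun=> 2%:E)) => //.
- move=> j; apply/measurable_EFinP.
  exact: (continuous_borel (@halfspace_cutoff_continuous R d n a j)).
- by move=> y _; apply: cvg_EFin; [exact: nearW|exact: halfspace_cutoff_cvg].
- exact: finite_measure_integrable_cst.
- move=> j y _; have /andP[? ?] := halfspace_cutoff_bounds n a j y.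
  by rewrite lee_fin ger0_norm.
Qed.

Lemma tail_integral_cvg :
  \int[nu]_(y in [set: borel_rV R d]) tail j y @[j --> \oo] --> (0 : R).
Proof.
apply: fine_cvg; rewrite -[X in _ --> X](_ : (\int[nu]_(y in setT) cst 0 y)%E = _);
  last exact: integral0.
apply: (@dominated_cvg _ _ _ nu _ measurableT _ _ (fun=> 1%:E)) => //.
- move=> j; apply/measurable_EFinP.
  exact: (continuous_borel (@tail_continuous R d j)).
- move=> y _; apply: cvg_near_cst; near=> j.
  by rewrite /tail cut_eq0 // subr_le0; near: j; exact: nbhs_infty_ger.
- exact: finite_measure_integrable_cst.
- move=> j y _; have /andP[? ?] := cut_bounds (`|y| - j%:R).
  by rewrite lee_fin ger0_norm.
Unshelve. all: by end_near. Qed.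

End FiniteMeasure.

Lemma dotNr (R : realType) d (y n : 'rV[R]_d) : (y *m (- n)^T) 0 0 = - (y *m n^T) 0 0.
Proof. by rewrite linearN /= mulmxN [LHS]mxE. Qed.

(** * Continuity of the masses of half-spaces *)

Section MassAssignmentContinuity.
Context (R : realType) (d k : nat) (mu : mass_assignment R d k).
Context (X : topologicalType) (V : X -> flat R d k).
Hypothesis V_continuous : continuous V.

Lemma mass_integral_continuous (h : 'rV[R]_d -> R) : bounded_continuous h ->
  continuous (fun x => \int[mu (V x)]_(y in [set: borel_rV R d]) h y).
Proof.
move=> bh x; pose hb : set_type (@bounded_continuous R d) := SigSub (mem_set bh).
have cb : continuous (@bundle_coord R d k) by exact: initial_continuous.
have cm := continuous_comp (@V_continuous x) (@mass_at_continuous _ _ _ mu (V x)).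
have cc := continuous_comp cm (cb _).
have cs : continuous
    (@snd (flat R d k) {ptws set_type (@bounded_continuous R d) -> R}).
  by move=> p; exact: cvg_snd.
have cp := @proj_continuous _ (fun=> R) hb.
exact: (continuous_comp (continuous_comp cc (cs _)) (cp _)).
Qed.

Let total x := fine (mu (V x) [set: borel_rV R d]).

Lemma mass_total_continuous : continuous total.
Proof.
have -> : total = fun x => \int[mu (V x)]_(y in [set: borel_rV R d]) 1.
  by apply/funext => x; rewrite Rintegral_cst // mul1r.
apply: mass_integral_continuous; split; first exact: cst_continuous.
by exists 1 => y; rewrite normr1.
Qed.

(** As in the portmanteau theorem, but with a moving half-space: one bounded continuous cut-off,
    with integral close to the mass at [x0], dominates the indicators of the half-spaces at all
    nearby [x], and its integral depends continuously on [x]. *)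
Lemma mass_halfspace_usc (n : X -> 'rV[R]_d) (a : X -> R) x0 e :
    continuous n -> continuous a -> 0 < e ->
  \forall x \near x0, fine (mu (V x) [set y | a x <= (y *m (n x)^T) 0 0]) <
                      fine (mu (V x0) [set y | a x0 <= (y *m (n x0)^T) 0 0]) + e.
Proof.
move=> cn ca e0.
have [j j0 Uj] : exists2 j : nat, (0 < j)%N &
    \int[mu (V x0)]_(y in [set: borel_rV R d]) halfspace_cutoff (n x0) (a x0) j y <
    fine (mu (V x0) [set y | a x0 <= (y *m (n x0)^T) 0 0]) + e.
  near \oo => j; exists j; first by near: j; exact: nbhs_infty_gt.
  near: j; apply: (cvgr_lt _ (@halfspace_cutoff_integral_cvg R d (mu (V x0)) (n x0) (a x0))).
  by rewrite ltrDl.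
have j0' : 0 < j%:R :> R by rewrite ltr0n.
pose U := halfspace_cutoff (n x0) (a x0) j.
have bU : bounded_continuous U by exact: halfspace_cutoff_bounded.
near=> x.
apply: (@le_lt_trans _ _ (\int[mu (V x)]_(y in [set: borel_rV R d]) U y)); last first.
  near: x; exact: (cvgr_lt _ (mass_integral_continuous bU (x := x0))).
apply: measure_le_integral => //.
- by apply: closed_borel; exact: closed_halfspace.
- by move=> y; have /andP[] := halfspace_cutoff_bounds (n x0) (a x0) j y.
move=> y /= axy; rewrite /U /halfspace_cutoff /slab /tail.
have /andP[t0 _] := cut_bounds (`|y| - j%:R).
have /andP[s0 _] := cut_bounds (2 + j%:R * ((y *m (n x0)^T) 0 0 - a x0)).
(* Far points are covered by [tail]. For |y| < j + 1 the passage from [x] to [x0] changes y . n - a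
   by less than 1/j, the margin of [slab]. *)
have [yj|yj] := leP (j%:R + 1) `|y|.
  by rewrite [cut (`|y| - _)]cut_eq1; lra.
rewrite [cut (2 + _)]cut_eq1; first lra.
have : d%:R * (j%:R + 1) * `|n x0 - n x| + `|a x0 - a x| < j%:R^-1.
  near: x.
  have cE : continuous (fun x => d%:R * (j%:R + 1) * `|n x0 - n x| + `|a x0 - a x|).
    apply: continuousT_add.
      apply: continuousT_mul; first exact: cst_continuous.
      move=> z; apply: (@continuous_comp _ _ _ (fun y => n x0 - n y) Num.norm).
        by apply: cvgB; [exact: cst_continuous|exact: cn].
      exact: norm_continuous.
    move=> z; apply: (@continuous_comp _ _ _ (fun y => a x0 - a y) Num.norm).
      by apply: continuousT_sub; [exact: cst_continuous|exact: ca].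
    exact: norm_continuous.
  apply: (cvgr_lt _ (cE x0)); rewrite !subrr !normr0 mulr0 addr0.
  by rewrite invr_gt0.
move=> small.
have dn : (y *m (n x0)^T) 0 0 = (y *m (n x)^T) 0 0 + (y *m (n x0 - n x)^T) 0 0.
  by rewrite linearB /= mulmxBr !mxE; lra.
have := dot_le_norm y (n x0 - n x); rewrite ler_norml => /andP[lo _].
have : d%:R * (`|y| * `|n x0 - n x|) <= d%:R * (j%:R + 1) * `|n x0 - n x|.
  by rewrite mulrA ler_wpM2r // ler_wpM2l // ltW.
have := ler_norm (a x0 - a x).
set b := _ - a x0 => a1 a2.
have : - j%:R^-1 <= b by rewrite /b dn; lra.
move=> /(ler_wpM2l (ltW j0')); rewrite mulrN mulfV ?gt_eqF //; lra.
Unshelve. all: by end_near. Qed.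

Definition upper_mass x (n : 'rV[R]_d) a : R :=
  fine (mu (V x) [set y | a <= (y *m n^T) 0 0]).

Definition lower_mass x (n : 'rV[R]_d) a : R :=
  fine (mu (V x) [set y | (y *m n^T) 0 0 <= a]).

Lemma lower_upper_mass x n a : lower_mass x n a = upper_mass x (- n) (- a).
Proof.
rewrite /lower_mass /upper_mass; congr (fine (mu (V x) _)); apply/funext => y /=.
by rewrite dotNr lerN2.
Qed.

Definition separates x (n : 'rV[R]_d) :=
  exists y y', [/\ flat_set (V x) y, flat_set (V x) y' &
                   (y *m n^T) 0 0 != (y' *m n^T) 0 0].

Lemma upper_lower_mass x n a : separates x n ->
  upper_mass x n a + lower_mass x n a = total x.
Proof.
move=> [y [y' [Vy Vy' yy']]].
have m1 : measurable ([set y | a <= (y *m n^T) 0 0] : set (borel_rV R d)).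
  by apply: closed_borel; exact: closed_halfspace.
have m2 : measurable ([set y | (y *m n^T) 0 0 <= a] : set (borel_rV R d)).
  by apply: closed_borel; exact: closed_halfspace_le.
rewrite /upper_mass /lower_mass -fineD ?fin_num_measure // /total; congr fine.
have -> : [set: borel_rV R d] =
    [set y | a <= (y *m n^T) 0 0] `|` [set y | (y *m n^T) 0 0 <= a].
  apply/seteqP; split=> // z _ /=.
  by case: (leP a ((z *m n^T) 0 0)) => [|/ltW]; [left|right].
rewrite measureUfinr //; last by rewrite -ge0_fin_numE ?fin_num_measure.
rewrite (_ : _ `&` _ = [set y | (y *m n^T) 0 0 = a]).
  rewrite [X in (_ - X)%E](_ : _ = 0%E) ?sube0 //.
  exact: (@mass_hyperplane _ _ _ _ (mu (V x)) n y y' a Vy Vy' yy').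
apply/seteqP; split=> z /= => [[az za]|->//].
by apply/eqP; rewrite eq_le za az.
Qed.

(** Both closed half-spaces have upper semicontinuous mass. Since the hyperplane between them is
    null, the two masses add up to the continuous total, so each is lower semicontinuous as well. *)
Lemma upper_mass_continuous (n : X -> 'rV[R]_d) (a : X -> R) :
    continuous n -> continuous a -> (forall x, separates x (n x)) ->
  continuous (fun x => upper_mass x (n x) (a x)).
Proof.
move=> cn ca sep x0; apply/cvgrPdist_lt => e e0.
have e2 : 0 < e / 2 by rewrite divr_gt0.
near=> x.
have up : upper_mass x (n x) (a x) < upper_mass x0 (n x0) (a x0) + e.
  by near: x; exact: mass_halfspace_usc.
have lo : lower_mass x (n x) (a x) < lower_mass x0 (n x0) (a x0) + e / 2.
  rewrite !lower_upper_mass; near: x.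
  apply: (@mass_halfspace_usc (fun x => - n x) (fun x => - a x)) => //.
    by move=> z; apply: cvgN; exact: cn.
  by move=> z; apply: cvgN; exact: ca.
have tot : total x0 - e / 2 < total x.
  by near: x; apply: (cvgr_gt _ (@mass_total_continuous x0)); rewrite ltrBlDr ltrDl.
have E := upper_lower_mass (a x) (sep x).
have E0 := upper_lower_mass (a x0) (sep x0).
by rewrite ltr_norml; apply/andP; split; lra.
Unshelve. all: by end_near. Qed.

(** A radius good at [x0] stays good nearby, because the integral of [tail] and the total are
    continuous; compactness then makes it uniform. *)
Lemma uniform_tail (K : set X) : compact K -> (forall x, 0 < total x) ->
  exists j : nat, forall x, K x ->
    2 * fine (mu (V x) [set y : 'rV[R]_d | j%:R <= `|y|]) < total x.
Proof.
move=> /compact_near_coveringP cK tpos.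
have mT (j : nat) : measurable ([set y | j%:R <= `|y|] : set (borel_rV R d)).
  apply: closed_borel; have /continuous_closedP := @norm_continuous R 'rV[R]_d.
  by move=> /(_ [set v | j%:R <= v]); apply; exact: closed_ge.
have [|N _ NK] := cK nat \oo
    (fun j x => 2 * fine (mu (V x) [set y | j%:R <= `|y|]) < total x) _ _.
  move=> x0 _.
  have [j jt] : exists j : nat,
      \int[mu (V x0)]_(y in [set: borel_rV R d]) tail j y < total x0 / 2.
    near \oo => j; exists j; near: j.
    by apply: (cvgr_lt _ (@tail_integral_cvg R d (mu (V x0)))); rewrite divr_gt0.
  have ct : continuous (fun x =>
      2 * \int[mu (V x)]_(y in [set: borel_rV R d]) tail j y - total x).
    apply: continuousT_sub; last exact: mass_total_continuous.
    apply: continuousT_mul; first exact: cst_continuous.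
    by apply: mass_integral_continuous; exact: tail_bounded.
  near=> x i.
  have : 2 * \int[mu (V x)]_(y in [set: borel_rV R d]) tail j y - total x < 0.
    by near: x; apply: (cvgr_lt _ (ct x0)); lra.
  suff : fine (mu (V x) [set y | i%:R <= `|y|]) <=
         \int[mu (V x)]_(y in [set: borel_rV R d]) tail j y by lra.
  apply: measure_le_integral => //; first exact: tail_bounded.
    by move=> y; have /andP[] := cut_bounds (`|y| - j%:R).
  move=> y /= iy; rewrite /tail cut_eq1 //.
  have : (j.+1)%:R <= i%:R :> R by rewrite ler_nat; near: i; exact: nbhs_infty_ge.
  by rewrite -natr1; lra.
by exists N => x; apply: NK => /=.
Unshelve. all: by end_near. Qed.

End MassAssignmentContinuity.

(** * Sections of vertical flats *)

Section Frames.
Context (R : realType).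

Section Span.
Context (d q : nat) (F : 'M[R]_(1 + q, d)) (Q : 'M[R]_(1 + q)).
Context (n : 'rV[R]_d) (B : 'M[R]_(q, d)) (a : R).
Hypotheses (FF : F *m F^T = 1%:M) (QQ : Q *m Q^T = 1%:M).
Hypothesis nB : col_mx n B = Q *m F.

Lemma boundary_frame_orthonormal : col_mx n B *m (col_mx n B)^T = 1%:M.
Proof. by rewrite nB trmx_mul !mulmxA -(mulmxA Q) FF mulmx1. Qed.

Let gram : [/\ n *m n^T = 1%:M, n *m B^T = 0, B *m n^T = 0 & B *m B^T = 1%:M].
Proof.
have := boundary_frame_orthonormal.
by rewrite tr_col_mx mul_col_row scalar_mx_block => /eq_block_mx.
Qed.

Lemma boundary_frame_orthonormalN : col_mx (- n) B *m (col_mx (- n) B)^T = 1%:M.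
Proof.
have [nn nBt Bn BB] := gram.
rewrite tr_col_mx mul_col_row linearN /= !mulmxN !mulNmx opprK nn nBt Bn BB !oppr0.
by rewrite [RHS]scalar_mx_block.
Qed.

Lemma boundary_orthonormal : B *m B^T = 1%:M.
Proof. by have [] := gram. Qed.

Let dot_nB t c : ((t *: n + c *m B) *m n^T) 0 0 = t.
Proof.
have [nn _ Bn _] := gram.
by rewrite mulmxDl -scalemxAl nn -mulmxA Bn mulmx0 addr0 !mxE eqxx mulr1.
Qed.

Let span_nB y : flat_span (0, F) y <-> exists t c, y = t *: n + c *m B.
Proof.
split=> [[c _ <-]|[t [c ->]]] /=.
  exists (lsubmx (c *m Q^T) 0 0), (rsubmx (c *m Q^T)); rewrite add0r.
  rewrite -mul_scalar_mx -mx11_scalar -mul_row_col hsubmxK nB.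
  by rewrite mulmxA -(mulmxA c) (mulmx1C QQ) mulmx1.
exists (row_mx t%:M c *m Q) => //=.
by rewrite add0r -mulmxA -nB mul_row_col mul_scalar_mx.
Qed.

(** As [Q] is orthogonal, [n] and the rows of [B] form another orthonormal frame of the flat, in
    which y . n is simply the coordinate along [n]. *)
Lemma flat_span_section : flat_span (a *: n, B) =
  flat_span (0, F) `&` [set y | (y *m n^T) 0 0 = a].
Proof.
apply/seteqP; split=> [_ [c _ <-] /=|y [/span_nB[t [c ->]] /=]].
  by split; [apply/span_nB; exists a, c|rewrite dot_nB].
by rewrite dot_nB => <-; exists c.
Qed.

Lemma half_flat_span_section : @half_flat_span R d q.+1 (a *: n, (n, B)) =
  flat_span (0, F) `&` [set y | a <= (y *m n^T) 0 0].
Proof.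
apply/seteqP; split=> [_ [t [c [t0 ->]]] /=|y [/span_nB[t [c ->]] /=]].
  rewrite -scalerDl; split; first by apply/span_nB; exists (a + t), c.
  by rewrite /= dot_nB lerDl.
by rewrite dot_nB => le_at; exists (t - a), c;
  rewrite subr_ge0 /= -scalerDl [a + _]addrC subrK.
Qed.

Lemma half_flat_span_sectionN : @half_flat_span R d q.+1 (a *: n, (- n, B)) =
  flat_span (0, F) `&` [set y | (y *m n^T) 0 0 <= a].
Proof.
apply/seteqP; split=> [_ [t [c [t0 ->]]] /=|y [/span_nB[t [c ->]] /=]].
  rewrite scalerN -scalerBl; split; first by apply/span_nB; exists (a - t), c.
  by rewrite /= dot_nB gerBl.
rewrite dot_nB => ta; exists (a - t), c.
by rewrite subr_ge0 /= scalerN -scalerBl subKr.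
Qed.

Lemma flat_span_separates : exists y y', [/\ flat_span (0, F) y, flat_span (0, F) y' &
  (y *m n^T) 0 0 != (y' *m n^T) 0 0].
Proof.
exists 0, n; split; [by exists 0; rewrite //= mul0mx addr0| |].
  by apply/span_nB; exists 1, 0; rewrite mul0mx addr0 scale1r.
by have [-> _ _ _] := gram; rewrite mul0mx !mxE eqxx eq_sym oner_eq0.
Qed.

End Span.

Context (p q : nat).

Definition vert_frame (v : 'rV[R]_(1 + p)) : 'M[R]_(1 + q, 1 + p + q) :=
  col_mx (row_mx v 0) (row_mx 0 1%:M).

Lemma vert_frame_orthonormal v : v *m v^T = 1%:M ->
  vert_frame v *m (vert_frame v)^T = 1%:M.
Proof.
move=> vv; rewrite /vert_frame tr_col_mx !tr_row_mx mul_col_row !mul_row_col.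
by rewrite !trmx0 trmx1 !mulmx0 !mul0mx mulmx1 vv !addr0 add0r -scalar_mx_block.
Qed.

Definition unit_normal (v : 'rV[R]_(1 + p)) (u0 : R) (w : 'rV[R]_q) : 'rV[R]_(1 + p + q) :=
  row_mx (u0 *: v) w.

(* The rotation of the (e_0, w)-plane that takes e_0 to the unit vector (u0, w)
   takes e_j to the j-th row below; it depends continuously on (u0, w) as long
   as u0 <> -1. *)
Definition boundary_frame (v : 'rV[R]_(1 + p)) (u0 : R) (w : 'rV[R]_q) :
    'M[R]_(q, 1 + p + q) :=
  row_mx (- (w^T *m v)) (1%:M - (1 + u0)^-1 *: (w^T *m w)).

Definition rotation (u0 : R) (w : 'rV[R]_q) : 'M[R]_(1 + q) :=
  block_mx u0%:M w (- w^T) (1%:M - (1 + u0)^-1 *: (w^T *m w)).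

Lemma rotation_frame v u0 w :
  col_mx (unit_normal v u0 w) (boundary_frame v u0 w) = rotation u0 w *m vert_frame v.
Proof.
rewrite /rotation /vert_frame mul_block_col !mul_mx_row !mulmx0 !mulmx1.
by rewrite !add_row_mx !addr0 !add0r mul_scalar_mx mulNmx.
Qed.

Lemma rotation_orthonormal u0 w : 0 <= u0 -> u0 ^+ 2 + (w *m w^T) 0 0 = 1 ->
  rotation u0 w *m (rotation u0 w)^T = 1%:M.
Proof.
move=> u00 uw; have u1 : 1 + u0 != 0 by rewrite gt_eqF // ltr_pwDl.
have ww : w *m w^T = (1 - u0 ^+ 2)%:M.
  by rewrite [LHS]mx11_scalar; congr _%:M; lra.
set D := w^T *m w; set c := (1 + u0)^-1.
have Dt : D^T = D by rewrite /D trmx_mul trmxK.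
have wD : w *m D = (1 - u0 ^+ 2) *: w by rewrite /D mulmxA ww mul_scalar_mx.
have DD : D *m D = (1 - u0 ^+ 2) *: D.
  by rewrite {1}/D -mulmxA wD -scalemxAr.
have cu : c * (1 - u0 ^+ 2) = 1 - u0 by rewrite /c; field.
have Et : (1%:M - c *: D)^T = 1%:M - c *: D by rewrite linearB /= trmx1 linearZ /= Dt.
rewrite /rotation -/c -/D tr_block_mx Et linearN /= trmxK tr_scalar_mx.
rewrite mulmx_block -/D [RHS]scalar_mx_block.
have wE : u0%:M *m (- w) + w *m (1%:M - c *: D) = 0.
  rewrite mulmxN mul_scalar_mx mulmxBr mulmx1 -scalemxAr wD scalerA cu.
  by rewrite scalerBl scale1r subKr addNr.
congr block_mx => //.
- by rewrite -scalar_mxM ww -raddfD /= -expr2 addrC subrK.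
- by rewrite -[RHS]trmx0 -wE linearD /= !trmx_mul Et tr_scalar_mx linearN /=.
- rewrite mulNmx mulmxN opprK mulmxBr mulmx1 mulmxBl mul1mx -scalemxAl -scalemxAr DD.
  (* The coefficient of D = w^T w in the lower right block of the product. *)
  have k : 1 - c - c + c * (c * (1 - u0 ^+ 2)) = 0 by rewrite cu /c; field.
  rewrite !scalerA -/D; move: D {Dt wD DD Et wE} => D.
  apply/matrixP => i j; rewrite !mxE -[RHS]addr0 -(mul0r (D i j)) -k; ring.
Qed.

End Frames.

(** * Half-spheres as images of cubes *)

Section SphereParametrization.
Context (R : realType).

Definition clamp (r : R) := Num.max (-1) (Num.min 1 r).

Lemma clamp_norm r : `|clamp r| <= 1.
Proof.
rewrite ler_norml /clamp le_max lexx /= ge_max ge_min lexx /= andbT.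
by rewrite (@le_trans _ _ 0) // ?lerN10.
Qed.

Lemma clamp_id r : `|r| <= 1 -> clamp r = r.
Proof. by rewrite ler_norml => /andP[r0 r1]; rewrite /clamp min_r // max_r. Qed.

Lemma clamp_ge1 r : 1 <= r -> clamp r = 1.
Proof. by move=> r1; rewrite /clamp min_l // max_r //; lra. Qed.

Lemma clamp_leN1 r : r <= -1 -> clamp r = -1.
Proof. by move=> r1; rewrite /clamp max_l // ge_min r1 orbT. Qed.

Lemma clampN r : clamp (- r) = - clamp r.
Proof.
have [r1|r1] := leP 1 r; first by rewrite [clamp r]clamp_ge1 // clamp_leN1 // lerN2.
have [rN1|rN1] := leP r (-1).
  by rewrite [clamp r]clamp_leN1 // opprK clamp_ge1 // lerNr.
by rewrite !clamp_id // ?normrN ler_norml; lra.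
Qed.

Lemma norm_clamp r : 1 <= `|r| -> `|clamp r| = 1.
Proof.
case: (leP 0 r) => r0; first by rewrite ger0_norm // => /clamp_ge1 ->; rewrite normr1.
by rewrite ltr0_norm // => r1; rewrite clamp_leN1 ?normrN1 //; lra.
Qed.

Lemma clamp_continuous : continuous clamp.
Proof.
move=> x; apply: (@continuous_max R R (fun=> -1) (fun y => Num.min 1 y)).
  exact: cst_continuous.
by apply: (@continuous_min R R (fun=> 1) id); [exact: cst_continuous|exact: cvg_id].
Qed.

Definition tip r (c : nat -> R) := \prod_(j < r) (1 - `|c j|).

(* Iterated join coordinates: the cube [-1,1]^r is mapped onto the upper half
   (first coordinate nonnegative) of the unit sphere of the l^1 norm. *)
Definition join_coord r (c : nat -> R) : 'rV[R]_(1 + r) :=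
  row_mx (tip r c)%:M (\row_(i < r) (c i * tip i c)).

(** If c_i tip_i = 0 and tip_i = 1, then c_i = 0 and tip_(i+1) = 1. Hence the vanishing of all other
    coordinates forces the first one to be 1. *)
Lemma join_coord_neq0 r c : join_coord r c != 0.
Proof.
apply/eqP => /(congr1 (fun x => (lsubmx x 0 0, rsubmx x))).
rewrite row_mxKl row_mxKr linear0 [rsubmx 0]linear0 !mxE eqxx mulr1n => -[c0 ci].
suff tip1 i : (i <= r)%N -> tip i c = 1 by move: c0; rewrite tip1 // => /eqP; rewrite oner_eq0.
elim: i => [|i IHi] ir; first by rewrite /tip big_ord0.
have ti := IHi (ltnW ir).
have /rowP/(_ (Ordinal ir)) := ci; rewrite !mxE /= ti mulr1 => ci0.
by rewrite /tip big_ord_recr /= -/(tip i c) ti ci0 normr0 subr0 mulr1.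
Qed.

Lemma tip_eq0 r c i : (i < r)%N -> `|c i| = 1 -> tip r c = 0.
Proof. by move=> ir ci; rewrite /tip (bigD1 (Ordinal ir)) //= ci subrr mul0r. Qed.

Lemma tipN r c : tip r (fun i => - c i) = tip r c.
Proof. by apply: eq_bigr => i _; rewrite normrN. Qed.

Lemma tip_ge0 r c : (forall i, `|c i| <= 1) -> 0 <= tip r c.
Proof. by move=> c1; apply: prodr_ge0 => i _; rewrite subr_ge0. Qed.

(** The condition puts the point on the rim of the half-sphere, where the first coordinate is 0. *)
Lemma join_coordN r c i : (i < r)%N -> `|c i| = 1 ->
  join_coord r (fun j => - c j) = - join_coord r c.
Proof.
move=> ir ci; rewrite /join_coord tipN opp_row_mx (tip_eq0 ir ci); congr row_mx.
  by rewrite raddf0 oppr0.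
by apply/rowP => j; rewrite !mxE tipN mulNr.
Qed.

Lemma eq_in_join_coord r c c' :
  (forall j, (j < r)%N -> c j = c' j) -> join_coord r c = join_coord r c'.
Proof.
move=> cc'; have tipE i : (i <= r)%N -> tip i c = tip i c'.
  by move=> ir; apply: eq_bigr => j _; rewrite cc' // (leq_trans _ ir).
rewrite /join_coord tipE //; congr row_mx; apply/rowP => j.
by rewrite !mxE cc' // tipE // ltnW.
Qed.

(** The first coordinate and all those belonging to a parameter after [i] contain the factor 1 -
    |c_i| = 0. *)
Lemma eq_join_coord r c c' i : (i < r)%N -> `|c i| = 1 ->
  (forall j, (j <= i)%N -> c j = c' j) -> join_coord r c = join_coord r c'.
Proof.
move=> ir ci cc'; have c'i : `|c' i| = 1 by rewrite -cc'.
rewrite /join_coord !(tip_eq0 ir) //; congr row_mx; apply/rowP => j; rewrite !mxE.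
have [ij|ji] := ltnP i j; first by rewrite !(tip_eq0 ij) // !mulr0.
rewrite cc' //; congr (_ * _); apply: eq_bigr => l _.
by rewrite cc' // (leq_trans _ ji) // ltnW.
Qed.

Definition normalize n (x : 'rV[R]_n) := (Num.sqrt ((x *m x^T) 0 0))^-1 *: x.

Lemma dot_self n (x : 'rV[R]_n) : (x *m x^T) 0 0 = \sum_i x 0 i ^+ 2.
Proof. by rewrite mxE; apply: eq_bigr => i _; rewrite mxE expr2. Qed.

Lemma dot_self_gt0 n (x : 'rV[R]_n) : x != 0 -> 0 < (x *m x^T) 0 0.
Proof.
move=> x0; rewrite lt_def dot_self sumr_ge0 ?andbT => [|i _]; last exact: sqr_ge0.
apply: contraNneq x0 => /eqP; rewrite psumr_eq0 => [/allP x0|i _]; last exact: sqr_ge0.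
by apply/eqP/rowP => i; have := x0 i (mem_index_enum _); rewrite sqrf_eq0 mxE => /eqP.
Qed.

Lemma normalize_unit n (x : 'rV[R]_n) : x != 0 -> normalize x *m (normalize x)^T = 1%:M.
Proof.
move=> /dot_self_gt0 x0.
rewrite /normalize linearZ /= -scalemxAl -scalemxAr scalerA -invfM -expr2.
rewrite sqr_sqrtr ?ltW // [LHS]mx11_scalar [X in X%:M]mxE mulVf //.
by rewrite gt_eqF.
Qed.

Lemma normalizeN n (x : 'rV[R]_n) : normalize (- x) = - normalize x.
Proof.
have xN : (- x)^T = - x^T by rewrite linearN.
by rewrite /normalize xN mulmxN mulNmx opprK scalerN.
Qed.

Lemma normalize_row_mxN n1 n2 (a : 'rV[R]_n1) (b : 'rV[R]_n2) :
  normalize (row_mx a (- b)) =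
  row_mx (lsubmx (normalize (row_mx a b))) (- rsubmx (normalize (row_mx a b))).
Proof.
rewrite /normalize !tr_row_mx !mul_row_col linearN /= mulmxN mulNmx opprK.
by rewrite !scale_row_mx row_mxKl row_mxKr scalerN.
Qed.

Lemma normalize_join_coordN r c : normalize (join_coord r (fun j => - c j)) =
  row_mx (lsubmx (normalize (join_coord r c))) (- rsubmx (normalize (join_coord r c))).
Proof.
rewrite -normalize_row_mxN /join_coord tipN; congr (normalize (row_mx _ _)).
by apply/rowP => j; rewrite !mxE tipN mulNr.
Qed.

Lemma normalize_continuous (X : topologicalType) n (h : X -> 'rV[R]_n) :
  continuous h -> (forall x, h x != 0) -> continuous (fun x => normalize (h x)).
Proof.
move=> ch h0; apply: mx_continuous => i j.
under eq_fun do rewrite mxE.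
apply: continuousT_mul; last exact: continuous_coord.
move=> x; apply: (@continuousV _ _ (fun x => Num.sqrt ((h x *m (h x)^T) 0 0))).
  by rewrite gt_eqF // sqrtr_gt0 dot_self_gt0.
apply: (@continuous_comp _ _ _ (fun x => (h x *m (h x)^T) 0 0)).
  by apply: continuous_coord; apply: mulmx_continuous => //; exact: trmx_continuous.
exact: sqrt_continuous.
Qed.

Lemma row_mx_continuous (X : topologicalType) m n1 n2
    (f : X -> 'M[R]_(m, n1)) (g : X -> 'M[R]_(m, n2)) :
  continuous f -> continuous g -> continuous (fun x => row_mx (f x) (g x)).
Proof.
move=> cf cg; apply: mx_continuous => i j; case: (split_ordP j) => l ->.
  under eq_fun do rewrite row_mxEl.
  exact: continuous_coord.
under eq_fun do rewrite row_mxEr.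
exact: continuous_coord.
Qed.

Lemma tip_continuous (X : topologicalType) r (c : X -> nat -> R) :
  (forall i, continuous (fun x => c x i)) -> continuous (fun x => tip r (c x)).
Proof.
move=> cc; elim: r => [|r IHr].
  under eq_fun do rewrite /tip big_ord0.
  exact: cst_continuous.
under eq_fun do rewrite /tip big_ord_recr /=.
apply: continuousT_mul => //; apply: continuousT_sub; first exact: cst_continuous.
by move=> x; apply: (continuous_comp (cc r x)); exact: norm_continuous.
Qed.

Lemma join_coord_continuous (X : topologicalType) r (c : X -> nat -> R) :
  (forall i, continuous (fun x => c x i)) -> continuous (fun x => join_coord r (c x)).
Proof.
move=> cc; apply: row_mx_continuous; apply: mx_continuous => i j.
  rewrite (ord1 i) (ord1 j); under eq_fun do rewrite mxE eqxx mulr1n.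
  exact: tip_continuous.
under eq_fun do rewrite mxE.
by apply: continuousT_mul => //; exact: tip_continuous.
Qed.

End SphereParametrization.

(** * Continuity of maps into the spaces of flats and half-flats *)

Section FrameContinuity.
Context (R : realType) (X : topologicalType) (d k : nat).

Lemma set_type_continuous (T : topologicalType) (A : set T) (h : X -> set_type A) :
  continuous (fun x => val (h x)) -> continuous h.
Proof. by move=> ch; apply: (@continuous_comp_initial _ _ _ (@set_val T A) h). Qed.

(** [flat_of_frame] is the canonical surjection of the quotient that defines the topology of
    flats. *)
Lemma flat_of_frame_continuous (h : X -> set_type (@flat_frames R d k)) :
  continuous (fun x => val (h x)) -> continuous (fun x => flat_of_frame (h x)).
Proof.
move=> /set_type_continuous ch x.
apply: (continuous_comp (ch x)).
have := @pi_continuous _ (flat R d k); rewrite generic_quotient.pi.unlock; exact.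
Qed.

Lemma half_flat_of_frame_continuous (h : X -> set_type (@half_flat_frames R d k)) :
  continuous (fun x => val (h x)) -> continuous (fun x => half_flat_of_frame (h x)).
Proof.
move=> /set_type_continuous ch x.
apply: (continuous_comp (ch x)).
have := @pi_continuous _ (half_flat R d k); rewrite generic_quotient.pi.unlock; exact.
Qed.

Lemma col_mx_continuous m1 m2 n
    (f : X -> 'M[R]_(m1, n)) (g : X -> 'M[R]_(m2, n)) :
  continuous f -> continuous g -> continuous (fun x => col_mx (f x) (g x)).
Proof.
move=> cf cg; apply: mx_continuous => i j; case: (split_ordP i) => l ->.
  under eq_fun do rewrite col_mxEu.
  exact: continuous_coord.
under eq_fun do rewrite col_mxEd.
exact: continuous_coord.
Qed.

Lemma scalemx_continuous m n (a : X -> R) (f : X -> 'M[R]_(m, n)) :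
  continuous a -> continuous f -> continuous (fun x => a x *: f x).
Proof.
move=> ca cf; apply: mx_continuous => i j; under eq_fun do rewrite mxE.
by apply: continuousT_mul => //; exact: continuous_coord.
Qed.

Lemma addmx_continuous m n (f g : X -> 'M[R]_(m, n)) :
  continuous f -> continuous g -> continuous (fun x => f x + g x).
Proof.
move=> cf cg; apply: mx_continuous => i j; under eq_fun do rewrite mxE.
by apply: continuousT_add; exact: continuous_coord.
Qed.

Lemma oppmx_continuous m n (f : X -> 'M[R]_(m, n)) :
  continuous f -> continuous (fun x => - f x).
Proof. by move=> cf x; apply: cvgN; exact: cf. Qed.

Lemma pair_continuous (U W : topologicalType) (f : X -> U) (g : X -> W) :
  continuous f -> continuous g -> continuous (fun x => (f x, g x)).
Proof. by move=> cf cg x; apply: cvg_pair; [exact: cf|exact: cg]. Qed.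

End FrameContinuity.

(* [S x] runs over the vertical linear flats, [n x] over their unit vectors (up to
   sign), and [T x a], [Hp x a], [Hm x a] are the sections of [S x] by the
   hyperplane [y . n x = a] and by the two half-spaces that it bounds. *)
Record vertical_family (R : realType) (p q : nat)
    (S : 'rV[R]_(p + q).+1 -> flat R (1 + p + q) q.+1)
    (n : 'rV[R]_(p + q).+1 -> 'rV[R]_(1 + p + q))
    (T : 'rV[R]_(p + q).+1 -> R -> flat R (1 + p + q) q)
    (Hp Hm : 'rV[R]_(p + q).+1 -> R -> half_flat R (1 + p + q) q.+1) : Prop := {
  family_linear : forall x, is_linear (S x);
  family_vertical : forall x, vertical q (S x);
  family_boundary : forall x a,
    flat_set (T x a) = flat_set (S x) `&` [set y | (y *m (n x)^T) 0 0 = a];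
  family_upper : forall x a,
    half_flat_set (Hp x a) = flat_set (S x) `&` [set y | a <= (y *m (n x)^T) 0 0];
  family_lower : forall x a,
    half_flat_set (Hm x a) = flat_set (S x) `&` [set y | (y *m (n x)^T) 0 0 <= a];
  family_separates : forall x, exists y y', [/\ flat_set (S x) y, flat_set (S x) y' &
    (y *m (n x)^T) 0 0 != (y' *m (n x)^T) 0 0];
  family_norm : forall x, `|n x| <= 1;
  family_continuous : continuous S;
  family_normal_continuous : continuous n;
  family_upper_continuous : forall a : 'rV[R]_(p + q).+1 -> R, continuous a ->
    continuous (fun x => Hp x (a x));
  family_lower_continuous : forall a : 'rV[R]_(p + q).+1 -> R, continuous a ->
    continuous (fun x => Hm x (a x));
  family_clamp : forall x : 'rV[R]_(p + q).+1, S x = S (\row_i clamp (x 0 i));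
  family_later : forall (i : 'I_(p + q).+1) (x y : 'rV[R]_(p + q).+1), (0 < i)%N ->
    1 <= `|x 0 i| ->
    (forall l : 'I_(p + q).+1, ~~ later p i l -> x 0 l = y 0 l) ->
    S x = S y /\ n x = n y;
  family_antipode : forall (i : 'I_(p + q).+1) (x : 'rV[R]_(p + q).+1), (0 < i <= p)%N ->
    1 <= `|x 0 i| ->
    S (- x) = S x /\ n (- x) = - n x;
  family_half_antipode : forall (i : 'I_(p + q).+1) (x : 'rV[R]_(p + q).+1), (p < i)%N ->
    1 <= `|x 0 i| ->
    let x' := \row_l (if (l == 0 :> nat) || (p < l)%N then - x 0 l else x 0 l) in
    S x' = S x /\ n x' = - n x
}.

(** * The parametrized family of vertical flats and their sections *)

Section VerticalFamily.
Context (R : realType) (p q : nat).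
Let m := (p + q).+1.
Implicit Types x y : 'rV[R]_m.

(** Clamping extends the parametrization from the cube [-1, 1]^m to the whole space. Coordinate 0,
    the offset, is skipped. *)
Let tcoord x (j : nat) := clamp (x 0 (inord j.+1)).
Let scoord x (j : nat) := clamp (x 0 (inord (p + j).+1)).
Let v x : 'rV[R]_(1 + p) := normalize (join_coord p (tcoord x)).
Let u x : 'rV[R]_(1 + q) := normalize (join_coord q (scoord x)).
Let u0 x : R := lsubmx (u x) 0 0.
Let w x : 'rV[R]_q := rsubmx (u x).
Let n x := unit_normal (v x) (u0 x) (w x).
Let B x := boundary_frame (v x) (u0 x) (w x).

Let v_unit x : v x *m (v x)^T = 1%:M.
Proof. exact/normalize_unit/join_coord_neq0. Qed.

Let u_unit x : u x *m (u x)^T = 1%:M.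
Proof. exact/normalize_unit/join_coord_neq0. Qed.

Let u0_ge0 x : 0 <= u0 x.
Proof.
rewrite /u0 /u /normalize linearZ /= row_mxKl mxE mulr_ge0 ?invr_ge0 ?sqrtr_ge0 //.
by rewrite mxE eqxx mulr1n tip_ge0 // => i; exact: clamp_norm.
Qed.

Let uw_unit x : u0 x ^+ 2 + (w x *m (w x)^T) 0 0 = 1.
Proof.
have := u_unit x; rewrite -{1 2}(hsubmxK (u x)) tr_row_mx mul_row_col.
move=> /matrixP/(_ 0 0); rewrite [LHS]mxE [RHS]mxE eqxx mulr1n => <-.
by congr (_ + _); rewrite mxE big_ord1 [_^T _ _]mxE expr2.
Qed.

Let FF x := vert_frame_orthonormal q (v_unit x).
Let QQ x := rotation_orthonormal (u0_ge0 x) (uw_unit x).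
Let nB x : col_mx (n x) (B x) = rotation (u0 x) (w x) *m vert_frame q (v x) :=
  rotation_frame _ _ _.

Let S_frame x : set_type (@flat_frames R (1 + p + q) q.+1) :=
  SigSub (mem_set (FF x : flat_frames (0, vert_frame q (v x)))).
Let T_frame x a : set_type (@flat_frames R (1 + p + q) q) :=
  SigSub (mem_set (boundary_orthonormal (FF x) (QQ x) (nB x) :
                     flat_frames (a *: n x, B x))).
Let Hp_frame x a : set_type (@half_flat_frames R (1 + p + q) q.+1) :=
  SigSub (mem_set (boundary_frame_orthonormal (FF x) (QQ x) (nB x) :
     @half_flat_frames R (1 + p + q) q.+1 (a *: n x, (n x, B x)))).
Let Hm_frame x a : set_type (@half_flat_frames R (1 + p + q) q.+1) :=
  SigSub (mem_set (boundary_frame_orthonormalN (FF x) (QQ x) (nB x) :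
     @half_flat_frames R (1 + p + q) q.+1 (a *: n x, (- n x, B x)))).

Let S x := flat_of_frame (S_frame x).
Let T x a := flat_of_frame (T_frame x a).
Let Hp x a := half_flat_of_frame (Hp_frame x a).
Let Hm x a := half_flat_of_frame (Hm_frame x a).

Let T_set x a : flat_set (T x a) = flat_set (S x) `&` [set y | (y *m (n x)^T) 0 0 = a].
Proof. exact: flat_span_section (FF x) (QQ x) (nB x). Qed.

Let Hp_set x a : half_flat_set (Hp x a) =
  flat_set (S x) `&` [set y | a <= (y *m (n x)^T) 0 0].
Proof. exact: half_flat_span_section (FF x) (QQ x) (nB x). Qed.

Let Hm_set x a : half_flat_set (Hm x a) =
  flat_set (S x) `&` [set y | (y *m (n x)^T) 0 0 <= a].
Proof. exact: half_flat_span_sectionN (FF x) (QQ x) (nB x). Qed.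

Let S_separates x : exists y y', [/\ flat_set (S x) y, flat_set (S x) y' &
  (y *m (n x)^T) 0 0 != (y' *m (n x)^T) 0 0].
Proof. exact: flat_span_separates (FF x) (QQ x) (nB x). Qed.

Let S_linear x : is_linear (S x).
Proof. by exists 0; rewrite //= mul0mx addr0. Qed.

Let S_vertical x : vertical q (S x).
Proof.
move=> i qi; exists 0 => t _; have ip : (1 + p <= i)%N by move: qi; lia.
have iq : (i - (1 + p) < q)%N by have := ltn_ord i; lia.
have E : row_mx (0 : 'M[R]_1) (t *: delta_mx 0 (Ordinal iq)) *m vert_frame q (v x) =
         t *: delta_mx 0 i.
  rewrite /vert_frame mul_row_col mul0mx add0r mul_mx_row mulmx0 mulmx1.
  apply/rowP => j; rewrite !mxE; case: (split_ordP j) => l ->; rewrite !mxE eqxx /=.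
    by rewrite -val_eqE /= (ltn_eqF (leq_trans (ltn_ord l) ip)) mulr0.
  congr (t * _%:R); apply: (congr1 nat_of_bool); rewrite -!val_eqE /=.
  by apply/eqP/eqP; lia.
exists (row_mx 0 (t *: delta_mx 0 (Ordinal iq)) : 'rV_(1 + q)) => //=.
by rewrite !add0r; exact: E.
Qed.

Let coord_continuousT (i : 'I_m) : continuous (fun x : 'rV[R]_m => clamp (x 0 i)).
Proof.
by move=> x; apply: (continuous_comp (@coord_continuous _ 1 m 0 i x)); exact: clamp_continuous.
Qed.

Let v_continuous : continuous v.
Proof.
apply: normalize_continuous => [|x]; last exact: join_coord_neq0.
by apply: join_coord_continuous => i; exact: coord_continuousT.
Qed.

Let u_continuous : continuous u.
Proof.
apply: normalize_continuous => [|x]; last exact: join_coord_neq0.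
by apply: join_coord_continuous => i; exact: coord_continuousT.
Qed.

Let u0_continuous : continuous u0.
Proof.
apply: (@continuous_coord _ _ _ _ (fun y => lsubmx (u y))) => y.
exact: (continuous_comp (@u_continuous y) (@continuous_lsubmx _ 1 1 q _)).
Qed.

Let w_continuous : continuous w.
Proof.
by move=> x; exact: (continuous_comp (@u_continuous x) (@continuous_rsubmx _ 1 1 q _)).
Qed.

Let n_continuous : continuous n.
Proof.
exact: (row_mx_continuous (scalemx_continuous u0_continuous v_continuous) w_continuous).
Qed.

Let B_continuous : continuous B.
Proof.
apply: row_mx_continuous.
  by apply/oppmx_continuous/mulmx_continuous => //; exact: trmx_continuous.
apply: addmx_continuous; first exact: cst_continuous.
apply/oppmx_continuous/scalemx_continuous.
  move=> x; apply: (@continuousV _ _ (fun x => 1 + u0 x)).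
    by rewrite gt_eqF // ltr_pwDl // u0_ge0.
  by apply: continuousT_add => //; exact: cst_continuous.
by apply: mulmx_continuous => //; exact: trmx_continuous.
Qed.

Let S_continuous : continuous S.
Proof.
apply: flat_of_frame_continuous; apply: pair_continuous; first exact: cst_continuous.
apply: (@col_mx_continuous R _ 1 q).
  exact: (row_mx_continuous v_continuous (@cst_continuous _ _ _)).
exact: cst_continuous.
Qed.

Let Hp_continuous (a : 'rV[R]_m -> R) : continuous a -> continuous (fun x => Hp x (a x)).
Proof.
move=> ca; apply: half_flat_of_frame_continuous; apply: pair_continuous.
  exact: scalemx_continuous.
exact: pair_continuous.
Qed.

Let Hm_continuous (a : 'rV[R]_m -> R) : continuous a -> continuous (fun x => Hm x (a x)).
Proof.
move=> ca; apply: half_flat_of_frame_continuous; apply: pair_continuous.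
  exact: scalemx_continuous.
by apply: pair_continuous => //; exact: oppmx_continuous.
Qed.

Let n_norm x : `|n x| <= 1.
Proof.
have [nn] : n x *m (n x)^T = 1%:M.
  have := boundary_frame_orthonormal (FF x) (QQ x) (nB x).
  by rewrite tr_col_mx mul_col_row scalar_mx_block => /eq_block_mx[].
rewrite [leLHS]/Num.Def.normr /= mx_normrE; apply/bigmax_leP; split=> // -[i j] _ /=.
rewrite (ord1 i) -(@ler_pXn2r _ 2) ?nnegrE // expr1n real_normK ?num_real //.
move/matrixP/(_ 0 0): nn; rewrite dot_self mxE eqxx mulr1n => <-.
by rewrite (bigD1 j) //= lerDl sumr_ge0 // => l _; exact: sqr_ge0.
Qed.

Let S_vert x y : v x = v y -> S x = S y.
Proof. by move=> vE; apply: flat_inj; rewrite /S /= vE. Qed.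

Let S_vertN x y : v x = - v y -> S x = S y.
Proof.
move=> vE; apply: flat_inj; rewrite /S /= vE.
have spanN (z : 'rV[R]_(1 + p)) :
    flat_span (0, vert_frame q (- z)) `<=` flat_span (0, vert_frame q z).
  move=> _ [c _ <-] /=.
  exists (row_mx (- lsubmx (c : 'rV_(1 + q))) (rsubmx (c : 'rV_(1 + q))) : 'rV_(1 + q)) => //=.
  rewrite !add0r; have cE := hsubmxK (c : 'rV_(1 + q)).
  have E (c1 : 'rV[R]_1) (c2 : 'rV[R]_q) :
      row_mx (- c1) c2 *m vert_frame q z = row_mx c1 c2 *m vert_frame q (- z).
    by rewrite /vert_frame !mul_row_col !mul_mx_row !mulmx0 mulmxN mulNmx.
  by rewrite [LHS]E cE.
apply/seteqP; split; first exact: spanN.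
by rewrite -{1}(opprK (v y)); exact: spanN.
Qed.

Let v_clamp x : v x = v (\row_i clamp (x 0 i)).
Proof.
rewrite /v; congr (normalize (join_coord p _)); apply/funext => j.
by rewrite /tcoord mxE [RHS]clamp_id // clamp_norm.
Qed.

Lemma vertical_family_exists : exists S n T Hp Hm, @vertical_family R p q S n T Hp Hm.
Proof.
have ix (i : 'I_m) x (j : nat) : j.+1 = i -> tcoord x j = clamp (x 0 i).
  move=> ji; rewrite /tcoord; congr (clamp (x 0 _)); apply: val_inj.
  by rewrite /= inordK // ji.
exists S, n, T, Hp, Hm; split.
- exact: S_linear.
- exact: S_vertical.
- exact: T_set.
- exact: Hp_set.
- exact: Hm_set.
- exact: S_separates.
- exact: n_norm.
- exact: S_continuous.
- exact: n_continuous.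
- exact: Hp_continuous.
- exact: Hm_continuous.
- by move=> x; apply: S_vert; exact: v_clamp.
- move=> i x y i0 xi xy.
  have coordE (j : nat) : ~~ later p i j -> (j < m)%N ->
      clamp (x 0 (inord j)) = clamp (y 0 (inord j)).
    by move=> nl jm; rewrite xy // inordK.
  have [ip|pi] := leqP i p.
    have vxy : v x = v y.
      rewrite /v (@eq_join_coord _ p (tcoord x) (tcoord y) i.-1) //; first by lia.
        by rewrite (ix i) ?norm_clamp // prednK.
      by move=> j ji; apply: coordE; rewrite /later /m; lia.
    have uxy : u x = u y.
      rewrite /u; congr normalize; apply: eq_in_join_coord => j jq.
      by apply: coordE; rewrite /later /m; lia.
    by split; [exact: S_vert|rewrite /n /u0 /w uxy vxy].
  have vxy : v x = v y.
    rewrite /v; congr normalize; apply: eq_in_join_coord => j jp.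
    by apply: coordE; rewrite /later /m; lia.
  have uxy : u x = u y.
    rewrite /u (@eq_join_coord _ q (scoord x) (scoord y) (i - p.+1)) //.
    + by have := ltn_ord i; rewrite /m; lia.
    + rewrite /scoord (_ : (inord _ : 'I_m) = i) ?norm_clamp //.
      by apply: val_inj; rewrite /= inordK; have := ltn_ord i; rewrite /m; lia.
    + by move=> j ji; apply: coordE; have := ltn_ord i; rewrite /later /m; lia.
  by split; [exact: S_vert|rewrite /n /u0 /w uxy vxy].
- move=> i x /andP[i0 ip] xi.
  have tN : v (- x) = - v x.
    rewrite /v -normalizeN -(@join_coordN _ p _ i.-1); first last.
    + by rewrite (ix i) ?norm_clamp // prednK.
    + by lia.
    congr (normalize (join_coord p _)); apply/funext => j.
    by rewrite /tcoord mxE clampN.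
  have uN : u (- x) = row_mx (lsubmx (u x)) (- rsubmx (u x)).
    rewrite /u -normalize_join_coordN; congr (normalize (join_coord q _)).
    by apply/funext => j; rewrite /scoord mxE clampN.
  split; first exact: S_vertN.
  by rewrite /n /unit_normal /u0 /w uN row_mxKl row_mxKr tN opp_row_mx scalerN.
- move=> i x pi xi x'.
  have vE : v x' = v x.
    rewrite /v; congr normalize; apply: eq_in_join_coord => j jp.
    by rewrite /tcoord /x' mxE inordK ?ifF //; [lia|rewrite /m; lia].
  have uN : u x' = row_mx (lsubmx (u x)) (- rsubmx (u x)).
    rewrite /u -normalize_join_coordN; congr normalize; apply: eq_in_join_coord => j jq.
    by rewrite /scoord /x' mxE inordK ?ifT ?clampN //; [lia|rewrite /m; lia].
  (* Coordinate [i] of the second block has clamped modulus 1, which makes the tip vanish. So n =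
     (0, w) is negated along with [w]. *)
  have u00 : u0 x = 0.
    rewrite /u0 /u /normalize linearZ /= row_mxKl mxE (@tip_eq0 _ q _ (i - p.+1)).
    + by rewrite [X in _ * X]mxE mul0rn mulr0.
    + by have := ltn_ord i; rewrite /m; lia.
    rewrite /scoord (_ : (inord _ : 'I_m) = i) ?norm_clamp //.
    by apply: val_inj; rewrite /= inordK; have := ltn_ord i; rewrite /m; lia.
  split; first exact: S_vert.
  rewrite /n /unit_normal vE opp_row_mx -scalerN u00 !scale0r -[w x]/(rsubmx (u x)).
  by rewrite {1}/u0 /w uN row_mxKl row_mxKr -/(u0 x) u00 scale0r.
Qed.

End VerticalFamily.

(** * Reduction of the bisection to the Borsuk-Ulam theorem *)

Section Bisection.
Context (R : realType) (p q : nat).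
Let m := (p + q).+1.
Variable mu : mass_assignment R (1 + p + q) q.+1.
Hypothesis mu_gt0 : forall V : flat R (1 + p + q) q.+1,
  is_linear V -> vertical q V -> (0 < mu V [set: 'rV[R]_(1 + p + q)])%E.
Variable f : 'I_(p + q) -> half_flat R (1 + p + q) q.+1 -> R.
Hypothesis f_continuous : forall i, continuous (f i).
Variables (S : 'rV[R]_m -> flat R (1 + p + q) q.+1) (n : 'rV[R]_m -> 'rV[R]_(1 + p + q)).
Variable T : 'rV[R]_m -> R -> flat R (1 + p + q) q.
Variables Hp Hm : 'rV[R]_m -> R -> half_flat R (1 + p + q) q.+1.
Hypothesis famP : vertical_family S n T Hp Hm.

Implicit Types x y : 'rV[R]_m.

Let total_gt0 x : 0 < fine (mu (S x) [set: borel_rV R (1 + p + q)]).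
Proof.
rewrite fine_gt0 // (mu_gt0 (family_linear famP x) (family_vertical famP x)) /=.
by rewrite -ge0_fin_numE ?fin_num_measure.
Qed.

Let up x a := upper_mass mu S x (n x) a.
Let lo x a := lower_mass mu S x (n x) a.

(** Index 0 carries the mass and the others carry the functions [f]. The factor [A] rescales the
    offsets, so that coordinates -1 and 1 can be placed where the mass difference has a known
    sign. *)
Let g (A : R) (k : 'I_m) x : R :=
  if unlift ord0 k is Some i
  then f i (Hp x (A * x 0 0)) - f i (Hm x (A * x 0 0))
  else up x (A * x 0 0) - lo x (A * x 0 0).

Let offset_continuous (A : R) : continuous (fun x => A * x 0 0).
Proof.
apply: continuousT_mul; first exact: cst_continuous.
exact: (@coord_continuous _ 1 m).
Qed.

Let g_continuous A k : continuous (g A k).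
Proof.
have cA := @offset_continuous A.
have cS := family_continuous famP; have cn := family_normal_continuous famP.
rewrite /g; case: unliftP => [i _|_].
  apply: continuousT_sub => x.
    have cH := family_upper_continuous famP cA.
    exact: (continuous_comp (cH x) (@f_continuous i _)).
  have cH := family_lower_continuous famP cA.
  exact: (continuous_comp (cH x) (@f_continuous i _)).
apply: continuousT_sub.
  have := @upper_mass_continuous _ _ _ mu _ S cS n (fun x => A * x 0 0).
  by apply; [exact: cn|exact: cA|exact: (family_separates famP)].
have -> : (fun x => lo x (A * x 0 0)) = fun x => upper_mass mu S x (- n x) (- (A * x 0 0)).
  by apply/funext => x; exact: lower_upper_mass.
have := @upper_mass_continuous _ _ _ mu _ S cS (fun x => - n x) (fun x => - (A * x 0 0)).
apply; first exact: (oppmx_continuous cn).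
  by move=> x; apply: (cvgN (@offset_continuous A x)).
move=> x; have [y [y' [Sy Sy' yy']]] := family_separates famP x; exists y, y'; split=> //.
by rewrite !dotNr eqr_opp.
Qed.

Let g_eq A k x y : S x = S y -> n x = n y -> x 0 0 = y 0 0 -> g A k x = g A k y.
Proof.
move=> Sxy nxy axy; rewrite /g -axy.
have -> : up y = up x by rewrite /up /upper_mass Sxy nxy.
have -> : lo y = lo x by rewrite /lo /lower_mass Sxy nxy.
case: unliftP => [i _|_]; last by [].
have -> : Hp y (A * x 0 0) = Hp x (A * x 0 0).
  by apply: half_flat_inj; rewrite !(family_upper famP) Sxy nxy.
have -> // : Hm y (A * x 0 0) = Hm x (A * x 0 0).
by apply: half_flat_inj; rewrite !(family_lower famP) Sxy nxy.
Qed.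

Let g_opp A k x y : S y = S x -> n y = - n x -> y 0 0 = - x 0 0 -> g A k y = - g A k x.
Proof.
move=> Sxy nxy axy; rewrite /g axy mulrN.
set a := A * x 0 0.
have HpE : [set z : 'rV[R]_(1 + p + q) | - a <= (z *m (n y)^T) 0 0] =
           [set z | (z *m (n x)^T) 0 0 <= a].
  by apply/funext => z; rewrite /mkset nxy dotNr lerN2.
have HmE : [set z : 'rV[R]_(1 + p + q) | (z *m (n y)^T) 0 0 <= - a] =
           [set z | a <= (z *m (n x)^T) 0 0].
  by apply/funext => z; rewrite /mkset nxy dotNr lerN2.
case: unliftP => [i _|_]; last by rewrite /up /lo /upper_mass /lower_mass HpE HmE Sxy opprB.
have -> : Hp y (- a) = Hm x a.
  by apply: half_flat_inj; rewrite (family_upper famP) (family_lower famP) Sxy HpE.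
have -> : Hm y (- a) = Hp x a.
  by apply: half_flat_inj; rewrite (family_upper famP) (family_lower famP) Sxy HmE.
by rewrite opprB.
Qed.

(** A half-space far from the origin lies in a tail that carries less than half of the positive
    total mass. [family_clamp] reduces uniformity in [x] to the compact cube. *)
Let uniform_offset : exists2 A : R, 0 < A & forall x a,
  (A <= a -> up x a < lo x a) /\ (a <= - A -> lo x a < up x a).
Proof.
pose K := [set x : 'rV[R]_m | forall i, `[(-1 : R), 1]%classic (x ord0 i)].
have cK : compact K.
  by apply: (@rV_compact _ _ (fun=> `[(-1 : R), 1]%classic)) => i; exact: segment_compact.
have [j jt] := uniform_tail (family_continuous famP) cK total_gt0.
have jtx x : 2 * fine (mu (S x) [set y : 'rV[R]_(1 + p + q) | j%:R <= `|y|]) <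
             fine (mu (S x) [set: borel_rV R (1 + p + q)]).
  rewrite (family_clamp famP); apply: jt => i /=.
  by rewrite mxE in_itv /= -ler_norml clamp_norm.
have mT : measurable ([set y | j%:R <= `|y|] : set (borel_rV R (1 + p + q))).
  apply: closed_borel; have /continuous_closedP := @norm_continuous R 'rV[R]_(1 + p + q).
  by move=> /(_ [set v | j%:R <= v]); apply; exact: closed_ge.
pose D := (1 + p + q)%:R : R; have D0 : 0 < D by rewrite ltr0n.
have far x (y : 'rV_(1 + p + q)) : D * j.+1%:R <= `|(y *m (n x)^T) 0 0| -> j%:R <= `|y|.
  move=> Dy; have yn := le_trans Dy (dot_le_norm y (n x)).
  have : D * j.+1%:R <= D * `|y|.
    apply: (le_trans yn); apply: ler_wpM2l; first exact: ltW.
    by apply: ler_piMr => //; exact: (family_norm famP x).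
  by rewrite ler_pM2l // -natr1; lra.
have small x (A : set 'rV[R]_(1 + p + q)) : measurable (A : set (borel_rV R (1 + p + q))) ->
    (forall y, A y -> D * j.+1%:R <= `|(y *m (n x)^T) 0 0|) ->
    2 * fine (mu (S x) A) < fine (mu (S x) [set: borel_rV R (1 + p + q)]).
  move=> mA Afar; apply: le_lt_trans (jtx x); rewrite ler_pM2l //.
  rewrite fine_le ?fin_num_measure // le_measure ?inE // => y /Afar.
  exact: far.
(* As |y . n| <= D |y| |n| and |n| <= 1, a point with |y . n| at least this large has norm at least
   j + 1. *)
exists (D * j.+1%:R) => [|x a]; first by rewrite mulr_gt0 ?ltr0n.
have sum := upper_lower_mass mu a (family_separates famP x).
split=> ha.
  have : 2 * up x a < fine (mu (S x) [set: borel_rV R (1 + p + q)]).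
    apply: small; first by apply: closed_borel; exact: closed_halfspace.
    by move=> y /= ay; rewrite ler_normr (le_trans ha ay).
  by rewrite -sum -/(up x a) -/(lo x a); lra.
have : 2 * lo x a < fine (mu (S x) [set: borel_rV R (1 + p + q)]).
  apply: small; first by apply: closed_borel; exact: closed_halfspace_le.
  by move=> y /= ya; rewrite ler_normr lerNr (le_trans ya ha) orbT.
by rewrite -sum -/(up x a) -/(lo x a); lra.
Qed.

Lemma bisecting_section : exists x a,
  bisects (fun H => mu (S x) (half_flat_set H)) (S x) (T x a) /\
  forall i, bisects (f i) (S x) (T x a).
Proof.
have [A A0 offA] := uniform_offset.
have g_zero : exists x, forall k, g A k x = 0.
  apply: borsuk_ulam_blowup.
  - exact: g_continuous.
  - move=> x; rewrite /g unlift_none; split=> x0.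
      by rewrite subr_lt0; apply: (offA x _).1; rewrite ler_peMr // ltW.
    rewrite subr_gt0; apply: (offA x _).2.
    by rewrite -mulrN1 ler_pM2l.
  - move=> k i x y i0 xi xy.
    have [Sxy nxy] := family_later famP i0 xi xy.
    by apply: g_eq => //; apply: xy; rewrite /later ltn0.
  - move=> k i x ip xi; have [Sx nx] := family_antipode famP ip xi.
    by apply: g_opp => //; rewrite mxE.
  - move=> k i x pi xi; have [Sx nx] := family_half_antipode famP pi xi.
    by apply: g_opp => //; rewrite mxE.
have [x gx] := g_zero.
have sd : sides (S x) (T x (A * x 0 0)) (Hp x (A * x 0 0)) (Hm x (A * x 0 0)).
  exists (n x), (A * x 0 0); split.
  - exact: (family_boundary famP).
  - exact: (family_upper famP).
  - exact: (family_lower famP).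
exists x, (A * x 0 0); split=> [|i]; exists (Hp x (A * x 0 0)), (Hm x (A * x 0 0)); split=> //.
  have /eqP := gx ord0; rewrite /g unlift_none subr_eq0 => /eqP ul.
  have m1 : measurable ([set y | A * x 0 0 <= (y *m (n x)^T) 0 0] :
      set (borel_rV R (1 + p + q))).
    by apply: closed_borel; exact: closed_halfspace.
  have m2 : measurable ([set y | (y *m (n x)^T) 0 0 <= A * x 0 0] :
      set (borel_rV R (1 + p + q))).
    by apply: closed_borel; exact: closed_halfspace_le.
  (* [Hp] and [Hm] are cut out of the flat, while [up] and [lo] measure whole half-spaces of the
     ambient space; the mass is carried by the flat. *)
  rewrite (family_upper famP) (family_lower famP) !mass_on //.
  rewrite -[LHS]fineK ?fin_num_measure // -[RHS]fineK ?fin_num_measure //.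
  by congr (_%:E); exact: ul.
have := gx (lift ord0 i); rewrite /g liftK => /eqP.
by rewrite subr_eq0 => /eqP.
Qed.

End Bisection.

(** The positivity of the mass on vertical linear flats enters through [uniform_offset]: it gives
    the mass difference opposite signs at the two ends of the offset interval. *)
Theorem theorem1p3 (R : realType) (d k : nat) (k_gt0 : (0 < k)%N)
  (k_le_d : (k <= d)%N) (mu : mass_assignment R d k)
  (mu_gt0 : forall V : flat R d k, is_linear V -> vertical k.-1 V ->
     (0 < mu V [set: 'rV[R]_d])%E)
  (f : 'I_d.-1 -> half_flat R d k -> R)
  (f_continuous : forall i, continuous (f i)) :
  exists (S : flat R d k) (T : flat R d k.-1),
    [/\ is_linear S, vertical k.-1 S, flat_set T `<=` flat_set S,
        bisects (fun H => mu S (half_flat_set H)) S T &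
        forall i, bisects (f i) S T].
Proof.
case: k k_gt0 => // q _ in k_le_d mu mu_gt0 f f_continuous *.
have [p dE] : exists p, d = (1 + p + q)%N by exists (d - q.+1)%N; lia.
subst d.
have [S [n [T [Hp [Hm famP]]]]] := vertical_family_exists R p q.
have [x [a [bm bf]]] := bisecting_section mu_gt0 f_continuous famP.
exists (S x), (T x a); split=> //.
- exact: (family_linear famP).
- exact: (family_vertical famP).
- by rewrite (family_boundary famP); exact: subIsetl.
Qed.
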